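(* Let $n\geq 1$, let $T\subseteq\mathbb{R}^n$ and let $\beta$ be the corresponding betweenness relation. Assume that $T$ extends linearly in 2D. Then the first-order theory of the class $\{(T,\beta,P) : P\subseteq T\text{ is finite}\}$ is $\Pi^0_1$-hard.
   Context: $\beta$ on $T$ is the restriction of the Euclidean betweenness relation: $\beta(s,t,u)$ iff $d(s,u)=d(s,t)+d(t,u)$, $d$ the Euclidean metric. $s,t,u$ are collinear iff $\beta(s,t,u)\vee\beta(s,u,t)\vee\beta(t,s,u)$. For $U\subseteq\mathbb{R}^n$, a line in $U$ is a set $L\subseteq U$ containing two distinct points, any three of whose points are collinear, and such that for $s\neq t$ in $L$ and $u\in U$, $\beta(s,u,t)$ or $\beta(s,t,u)$ implies $u\in L$. An $m$-dimensional flat of $\mathbb{R}^n$ is a set $\{h+r_1v_1+\dots+r_mv_m : r_i\in\mathbb{R}\}$ for some $h\in\mathbb{R}^n$ and linearly independent nonzero $v_1,\dots,v_m$. A nonempty $U\subseteq\mathbb{R}^n$ is a linearly regular $m$-dimensional flat if: $U$ is contained in some $m$-dimensional flat; $U$ is not contained in any $(m-1)$-dimensional flat; $U$ is linearly complete (for every line $L$ in $U$, with $L'$ the line of $\mathbb{R}^n$ containing $L$, every point of $L'$ is a limit of points of $L$); and $U$ is linearly closed (if $L_1\neq L_2$ are lines in $U$ whose extensions to lines of $\mathbb{R}^n$ intersect, then $L_1\cap L_2\neq\emptyset$). $T$ extends linearly in 2D if there exist a linearly regular 2-dimensional flat $S$, $\epsilon>0$ and $x\in S\cap T$ with $\{u\in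 S: d(x,u)<\epsilon\}\subseteq T$. The first-order theory of a class of $\{\beta,P\}$-structures is the set of first-order $\{\beta,P\}$-sentences true in all members of the class. Hardness is with respect to computable many-one reductions. *)

(* Defs.v *)
From mathcomp Require Import all_boot all_order all_algebra.
From mathcomp Require Import boolp classical_sets functions cardinality reals.
From mathcomp Require Import topology normedtype.

Set Implicit Arguments.
Unset Strict Implicit.
Unset Printing Implicit Defensive.

Import Order.TTheory GRing.Theory Num.Theory.
Import numFieldNormedType.Exports.

Local Open Scope classical_set_scope.

(** * Computability *)

(* Kleene's partial recursive functions: [recfun k] is the type of programs
   for k-ary functions, and [rec_eval c v y] says that [c] converges on the
   input [v] with value [y]. *)
Inductive recfun : nat -> Type :=
| RZero k : recfun k
| RSucc : recfun 1
| RProj k (i : 'I_k) : recfun k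
| RComp k l (f : recfun k) (g : 'I_k -> recfun l) : recfun l
| RPrec k (f : recfun k) (g : recfun k.+2) : recfun k.+1
| RMu k (f : recfun k.+1) : recfun k.

Fixpoint rec_eval k (c : recfun k) : k.-tuple nat -> nat -> Prop :=
  match c in recfun k return k.-tuple nat -> nat -> Prop with
  | RZero _ => fun _ y => y = 0
  | RSucc => fun v y => y = (thead v).+1
  | RProj _ i => fun v y => y = tnth v i
  | RComp k l f g => fun v y =>
      exists w : k.-tuple nat,
        (forall i, rec_eval (g i) v (tnth w i)) /\ rec_eval f w y
  (* h(0, x) = f(x) and h(i + 1, x) = g(i, h(i, x), x); [s i] is h(i, x) *)
  | RPrec k f g => fun v y =>
      exists s : nat -> nat,
        [/\ rec_eval f (behead_tuple v) (s 0),
            forall i, i < thead v ->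
              rec_eval g [tuple of i :: s i :: behead_tuple v] (s i.+1)
          & y = s (thead v)]
  | RMu k f => fun v y =>
      rec_eval f [tuple of y :: v] 0 /\
      forall z, z < y -> exists u, rec_eval f [tuple of z :: v] u.+1
  end.

Definition computable k (F : k.-tuple nat -> nat) : Prop :=
  exists c : recfun k, forall v, rec_eval c v (F v).

Definition computable1 (f : nat -> nat) : Prop :=
  computable (fun v : 1.-tuple nat => f (thead v)).

Definition decidable2 (r : nat -> nat -> bool) : Prop :=
  computable (fun v : 2.-tuple nat =>
    nat_of_bool (r (tnth v ord0) (tnth v ord_max))).

Definition Pi01 (B : set nat) : Prop :=
  exists2 r : nat -> nat -> bool,
    decidable2 r & forall x, B x <-> forall y, r x y.

Definition many_one_reducible (B A : set nat) : Prop :=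
  exists2 f : nat -> nat, computable1 f & forall x, B x <-> A (f x).

Definition Pi01_hard (A : set nat) : Prop :=
  forall B, Pi01 B -> many_one_reducible B A.

(** * First-order logic with equality over the vocabulary {beta, P} *)

Inductive formula : Type :=
| FEq (x y : nat)
| FBeta (x y z : nat)
| FP (x : nat)
| FNot (phi : formula)
| FAnd (phi psi : formula)
| FOr (phi psi : formula)
| FImp (phi psi : formula)
| FAll (x : nat) (phi : formula)
| FEx (x : nat) (phi : formula).

Fixpoint free_vars (phi : formula) : seq nat :=
  match phi with
  | FEq x y => [:: x; y]
  | FBeta x y z => [:: x; y; z]
  | FP x => [:: x]
  | FNot phi => free_vars phi
  | FAnd phi psi | FOr phi psi | FImp phi psi =>
      free_vars phi ++ free_vars psi
  | FAll x phi | FEx x phi => [seq y <- free_vars phi | y != x]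
  end.

Definition sentence (phi : formula) : bool := free_vars phi == [::].

Record structure : Type := Structure {
  domain :> Type;
  beta_rel : domain -> domain -> domain -> Prop;
  P_rel : domain -> Prop
}.

Fixpoint sat (M : structure) (rho : nat -> M) (phi : formula) : Prop :=
  match phi with
  | FEq x y => rho x = rho y
  | FBeta x y z => beta_rel (rho x) (rho y) (rho z)
  | FP x => P_rel (rho x)
  | FNot phi => ~ sat rho phi
  | FAnd phi psi => sat rho phi /\ sat rho psi
  | FOr phi psi => sat rho phi \/ sat rho psi
  | FImp phi psi => sat rho phi -> sat rho psi
  | FAll x phi => forall a : M, sat [eta rho with x |-> a] phi
  | FEx x phi => exists a : M, sat [eta rho with x |-> a] phi
  end.

(* The value of a sentence does not depend on the assignment; as usual,
   structures are meant to have a nonempty domain. *)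
Definition models (M : structure) (phi : formula) : Prop :=
  forall rho : nat -> M, sat rho phi.

(* A class of structures is a predicate of type [structure -> Prop]: writing
   [set structure] would conflict with the universe of [set_type]. *)
Definition theory (K : structure -> Prop) : set formula :=
  [set phi | sentence phi /\ forall M, K M -> models M phi].

(* Goedel numbering, through the bijection [CodeSeq.code : seq nat -> nat] *)
Fixpoint godel_code (phi : formula) : nat :=
  CodeSeq.code
    match phi with
    | FEq x y => [:: 0; x; y]
    | FBeta x y z => [:: 1; x; y; z]
    | FP x => [:: 2; x]
    | FNot phi => [:: 3; godel_code phi]
    | FAnd phi psi => [:: 4; godel_code phi; godel_code psi]
    | FOr phi psi => [:: 5; godel_code phi; godel_code psi]
    | FImp phi psi => [:: 6; godel_code phi; godel_code psi]
    | FAll x phi => [:: 7; x; godel_code phi]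
    | FEx x phi => [:: 8; x; godel_code phi]
    end.

Lemma godel_code_inj : injective godel_code.
Proof.
elim=> [x y|x y z|x|p IHp|p IHp q IHq|p IHp q IHq|p IHp q IHq|x p IHp|x p IHp]
  [x' y'|x' y' z'|x'|p'|p' q'|p' q'|p' q'|x' p'|x' p'];
  move=> /(can_inj CodeSeq.codeK) // [];
  by [move=> -> ->|move=> -> -> ->|move=> ->|move=> /IHp ->
     |move=> /IHp -> /IHq ->|move=> -> /IHp ->].
Qed.

Definition theory_codes (K : structure -> Prop) : set nat :=
  godel_code @` theory K.

(** * Geometry of R^n *)

Section Geometry.
Local Open Scope ring_scope.
Variables (R : realType) (n : nat).
Implicit Types (s t u x : 'rV[R]_n) (S T U L F : set 'rV[R]_n).

(* The norm that the library puts on ['rV[R]_n] is the sup norm, hence the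
   explicit Euclidean metric. *)
Definition euclid_dist s t : R := Num.sqrt (\sum_(i < n) (s 0 i - t 0 i) ^+ 2).

Definition betw s t u : Prop :=
  euclid_dist s u = euclid_dist s t + euclid_dist t u.

Definition collinear s t u : Prop := [\/ betw s t u, betw s u t | betw t s u].

Definition is_line U L : Prop :=
  [/\ L `<=` U,
      exists s t, [/\ L s, L t & s != t],
      forall s t u, L s -> L t -> L u -> collinear s t u
    & forall s t u, L s -> L t -> s != t -> U u ->
        betw s u t \/ betw s t u -> L u].

Definition is_flat (m : nat) F : Prop :=
  exists (h : 'rV[R]_n) (V : 'M[R]_(m, n)),
    row_free V /\ F = [set h + r *m V | r in [set: 'rV[R]_m]].

(* The product topology of ['rV[R]_n], used by [closure], is the Euclidean
   one. *)
Definition linearly_complete U : Prop :=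
  forall L L', is_line U L -> is_line [set: 'rV[R]_n] L' -> L `<=` L' ->
    L' `<=` closure L.

Definition linearly_closed U : Prop :=
  forall L1 L2 L1' L2', is_line U L1 -> is_line U L2 -> L1 <> L2 ->
    is_line [set: 'rV[R]_n] L1' -> is_line [set: 'rV[R]_n] L2' ->
    L1 `<=` L1' -> L2 `<=` L2' ->
    L1' `&` L2' !=set0 -> L1 `&` L2 !=set0.

(* There is no flat of dimension -1, so the third condition is void when
   [m = 0]. *)
Definition linearly_regular_flat (m : nat) U : Prop :=
  [/\ U !=set0,
      exists2 F, is_flat m F & U `<=` F,
      forall k F, m = k.+1 -> is_flat k F -> ~ (U `<=` F),
      linearly_complete U
    & linearly_closed U].

Definition extends_linearly_in_2D T : Prop :=
  exists S (eps : R) x,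
    [/\ linearly_regular_flat 2 S, 0 < eps, (S `&` T) x
      & [set u | S u /\ euclid_dist x u < eps] `<=` T].

Definition betw_structure T (P : set 'rV[R]_n) : structure :=
  @Structure (set_type T)
    (fun a b c => betw (val a) (val b) (val c))
    (fun a => P (val a)).

Definition finite_P_class T (M : structure) : Prop :=
  exists P, [/\ P `<=` T, finite_set P & M = betw_structure T P].

End Geometry.

(* Main.v *)
(** Programs are compiled to Horn rules: for every subprogram [c'] there is a
    relation containing the tuples [y :: v] such that [c'] maps [v] to [y], and
    each rule says that a tuple in such a relation is justified by other tuples.
    A finite set of facts in which every fact is justified is a finite
    computation, and every true fact belongs to such a set; only zero and
    successor are needed to write the rules.

    A finite set [P] represents a set of facts as follows. Numbers are points of
    [P] on a ray from a point O, and the value of a point is the number of points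
    of [P] strictly between O and it, so that zero and successor are definable
    from beta. The facts are concatenated to one word over the numbers (and
    some extra letters, one for each relation), and the word is drawn as the
    graph of a function from the points of a second ray to those of the first,
    a pair (y, v) being represented by the intersection of the segments vB and
    yA, where A and B are the points at infinity of the two rays.

    If the sentence saying that all facts are justified and that there is a fact
    r x y = 0 holds for some finite [P] inside an arbitrary [T], then induction
    on programs with the values of points shows that r x y = 0 for some y.
    Conversely, the required finite picture is part of a projective image of the
    grid of natural numbers. A linearly regular 2-dimensional flat contains a
    small triangle with an interior point; from these four points the grid is
    obtained by intersecting lines, and it stays inside the triangle. *)

From HB Require Import structures.
Require Import Defs.
From mathcomp Require Import all_boot all_order all_algebra.
From mathcomp Require Import boolp classical_sets functions cardinality reals.
From mathcomp Require Import topology normedtype ring lra.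

Set Implicit Arguments.
Unset Strict Implicit.
Unset Printing Implicit Defensive.

(** * Computable functions *)

Lemma behead_consK k x (v : k.-tuple nat) : behead_tuple (cons_tuple x v) = v.
Proof. exact: val_inj. Qed.

Lemma rec_eval_precE k (f : recfun k) g (v : k.+1.-tuple nat) y :
  rec_eval (RPrec f g) v y <->
  exists s : nat -> nat,
    [/\ rec_eval f (behead_tuple v) (s 0),
        forall i, i < thead v ->
          rec_eval g (cons_tuple i (cons_tuple (s i) (behead_tuple v))) (s i.+1)
      & y = s (thead v)].
Proof. by []. Qed.

(** With the next lemma this trades the trace [s] of a primitive recursion for the usual two
    recursion equations, on which inductions over the recursion argument run. *)
Lemma rec_eval_prec0 k (f : recfun k) g (x : k.-tuple nat) y :
  rec_eval (RPrec f g) (cons_tuple 0 x) y <-> rec_eval f x y.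
Proof.
rewrite rec_eval_precE behead_consK; split=> [[s []]|fxy]; first by move=> ? _ ->.
by exists (fun=> y).
Qed.

Lemma rec_eval_precS k (f : recfun k) g m (x : k.-tuple nat) y :
  rec_eval (RPrec f g) (cons_tuple m.+1 x) y <->
  exists2 s, rec_eval (RPrec f g) (cons_tuple m x) s
           & rec_eval g (cons_tuple m (cons_tuple s x)) y.
Proof.
rewrite rec_eval_precE behead_consK; split=> [[s [fx gx ->]]|[a]].
  exists (s m); last exact: gx.
  apply/rec_eval_precE; exists s; rewrite behead_consK.
  by split=> // i im; exact/gx/ltnW.
move=> /rec_eval_precE[s]; rewrite behead_consK => -[fx gx ->] gy.
(* The trace up to [m] is prolonged by the new value [y] at [m.+1]. *)
exists (fun i => if i <= m then s i else y); rewrite /thead !tnth0 ltnn.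
split=> // i.
rewrite ltnS; case: (ltngtP i m) => // [im|->] _.
  by apply: gx; rewrite /thead tnth0.
by move: gy; rewrite /thead tnth0.
Qed.

Lemma rec_eval_fun k (c : recfun k) v y y' :
  rec_eval c v y -> rec_eval c v y' -> y = y'.
Proof.
elim: c v y y' => {k} [k||k i|k l f IHf g IHg|k f IHf g IHg|k f IHf] v y y' /=.
- by move=> -> ->.
- by move=> -> ->.
- by move=> -> ->.
- move=> [w [gw fw]] [w' [gw' fw']]; apply: IHf fw _.
  suff -> : w = w' by [].
  by apply: eq_from_tnth => i; exact: IHg (gw i) (gw' i).
- move=> [s [f0 gs ->]] [s' [f0' gs' ->]].
  suff: forall i, i <= thead v -> s i = s' i by apply.
  elim=> [_|i IHi iv]; first exact: IHf f0 f0'.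
  by apply: IHg (gs _ iv) _; rewrite (IHi (ltnW iv)); exact: gs'.
(* If [y] and [y'] differed, [f] would be both zero and positive at the smaller one. *)
- move=> [f0 fS] [f0' fS']; case: (ltngtP y y') => // yy'.
    by have [u /(IHf _ _ _ f0)] := fS' _ yy'.
  by have [u /(IHf _ _ _ f0')] := fS _ yy'.
Qed.

Lemma computable_comp k l (F : k.-tuple nat -> nat)
    (G : 'I_k -> l.-tuple nat -> nat) :
  computable F -> (forall i, computable (G i)) ->
  computable (fun v => F [tuple G i v | i < k]).
Proof.
move=> [f fP] /choice[g gP]; exists (RComp f g) => v /=.
by exists [tuple G i v | i < k]; split=> // i; rewrite tnth_mktuple; exact: gP.
Qed.

Lemma computable_prec k (F : k.-tuple nat -> nat) (G : k.+2.-tuple nat -> nat) :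
  computable F -> computable G ->
  computable (fun v : k.+1.-tuple nat =>
    iteri (thead v) (fun i s => G (cons_tuple i (cons_tuple s (behead_tuple v))))
          (F (behead_tuple v))).
Proof.
move=> [f fP] [g gP]; exists (RPrec f g) => v /=.
exists (fun n => iteri n (fun i s => G (cons_tuple i (cons_tuple s (behead_tuple v))))
          (F (behead_tuple v))).
by split=> // i _; exact: gP.
Qed.

Lemma computable_ext k (F G : k.-tuple nat -> nat) :
  F =1 G -> computable F -> computable G.
Proof. by move=> FG [c cP]; exists c => v; rewrite -FG. Qed.

Lemma computable_proj k (i : 'I_k) : computable (fun v => tnth v i).
Proof. by exists (RProj i). Qed.

Lemma computableS k (F : k.-tuple nat -> nat) :
  computable F -> computable (fun v => (F v).+1).
Proof.
move=> cF; have cS : computable (fun v : 1.-tuple nat => (thead v).+1).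
  by exists RSucc.
apply: computable_ext (computable_comp cS (fun=> cF)) => v /=.
by rewrite [thead _]tnth_mktuple.
Qed.

Lemma computable_const k m : computable (fun _ : k.-tuple nat => m).
Proof. by elim: m => [|m]; [exists (RZero k) | exact: computableS]. Qed.

Lemma computable1_comp k f (G : k.-tuple nat -> nat) :
  computable1 f -> computable G -> computable (fun v => f (G v)).
Proof.
move=> cf cG; apply: computable_ext (computable_comp cf (fun=> cG)) => v /=.
by rewrite [thead _]tnth_mktuple.
Qed.

Lemma computable1_iter f m : computable1 f -> computable1 (fun n => iter n f m).
Proof.
move=> cf; have cG : computable (fun v : 2.-tuple nat => f (tnth v ord_max)).
  exact: computable1_comp cf (computable_proj _).
apply: computable_ext (computable_prec (computable_const 0 m) cG) => v.
by elim: (thead v) => //= n ->.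
Qed.

Lemma computable_double k (F : k.-tuple nat -> nat) :
  computable F -> computable (fun v => (F v).*2).
Proof.
apply: (@computable1_comp _ double).
have cS : computable1 (fun n => n.+2).
  exact/computableS/computableS/(computable_proj (ord0 : 'I_1)).
apply: computable_ext (computable1_iter 0 cS) => v.
by elim: (thead v) => //= n ->; rewrite doubleS.
Qed.

(** The step of the fold that defines [CodeSeq.code]; a code of a list of fixed length unfolds to
    nested applications of it. *)
Definition code_cons (n m : nat) := 2 ^ n * m.*2.+1.

Lemma computable_code_cons k (F G : k.-tuple nat -> nat) :
  computable F -> computable G -> computable (fun v => code_cons (F v) (G v)).
Proof.
move=> cF cG.
have cD : computable (fun v : 3.-tuple nat => (tnth v (@Ordinal 3 1 isT)).*2).
  exact/computable_double/computable_proj.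
have cI : computable (fun v : 1.-tuple nat => (thead v).*2.+1).
  exact/computableS/computable_double/(computable_proj ord0).
have cC := computable_prec cI cD.
pose H (i : 'I_2) := if i == ord0 then F else G.
have cH i : computable (H i) by rewrite /H; case: ifP.
apply: computable_ext (computable_comp cC cH) => v.
have -> : [tuple H i v | i < 2] = [tuple F v; G v].
  apply: eq_from_tnth => i; rewrite tnth_mktuple /H.
  by case: i => [[|[|]]].
rewrite behead_consK !theadE /code_cons; elim: (F v) => [|n IHn] /=.
  by rewrite mul1n.
by rewrite {1}/tnth /= IHn expnS -mul2n mulnA.
Qed.

(** * Programs as Horn rules *)

Definition label := seq nat.

Inductive atom : Type :=
| AZero (x : nat)
| ASucc (x y : nat)
| AEq (x y : nat)
| ARel (l : label) (xs : seq nat).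

HB.instance Definition _ := gen_eqMixin atom.

(* In a rule the variables below [rarity] are the arguments of the head; the
   others are existentially quantified in each of the clauses. *)
Record rule : Type := Rule {
  rlabel : label;
  rarity : nat;
  rclauses : seq (seq atom)
}.

HB.instance Definition _ := gen_eqMixin rule.

Section RuleSemantics.
Variables (D : Type) (Z : D -> Prop) (S : D -> D -> Prop).
Variable Rel : label -> seq D -> Prop.

Definition atom_holds (e : nat -> D) (a : atom) : Prop :=
  match a with
  | AZero x => Z (e x)
  | ASucc x y => S (e x) (e y)
  | AEq x y => e x = e y
  | ARel l xs => Rel l (map e xs)
  end.

Definition clause_holds (e : nat -> D) (b : seq atom) : Prop :=
  foldr (fun a Q => atom_holds e a /\ Q) True b.

(** The implication runs from the head to the clauses, against the usual reading of Horn rules: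
    facts must have reasons, but consequences need not be present. This is why finite relations can
    satisfy it. *)
Definition rule_holds (r : rule) : Prop :=
  forall e, Rel (rlabel r) (map e (iota 0 (rarity r))) ->
  exists2 b, b \in rclauses r
    & exists2 e', (forall i, i < rarity r -> e' i = e i) & clause_holds e' b.

Lemma clause_holdsP e b :
  clause_holds e b <-> forall a, a \in b -> atom_holds e a.
Proof.
elim: b => [|a b IHb] //=; split=> [[ha /IHb hb] a'|h].
  by rewrite inE => /predU1P[->|/hb].
by split; [apply: h; rewrite mem_head|apply/IHb => a' a'b; apply: h; rewrite inE a'b orbT].
Qed.

End RuleSemantics.

(* The relation labelled [p] is the set of all [y :: v] such that [c] maps [v]
   to [y]; the subprograms of [c] have the labels [i :: p]. For [RMu] the
   relation [1 :: p] contains [z :: v] when [f] is positive on all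
   [z' :: v], z' < z. *)
Fixpoint rules k (c : recfun k) (p : label) : seq rule :=
  match c with
  | RZero k => [:: Rule p k.+1 [:: [:: AZero 0]]]
  | RSucc => [:: Rule p 2 [:: [:: ASucc 1 0]]]
  | RProj k i => [:: Rule p k.+1 [:: [:: AEq 0 i.+1]]]
  | RComp k l f g =>
      Rule p l.+1
        [:: ARel (0 :: p) (0 :: iota l.+1 k)
         :: [seq ARel (i.+1 :: p) (l.+1 + i :: iota 1 l) | i : 'I_k <- enum 'I_k]]
      :: rules f (0 :: p)
      ++ flatten [seq rules (g i) (i.+1 :: p) | i <- enum 'I_k]
  | RPrec k f g =>
      Rule p k.+2
        [:: [:: AZero 1; ARel (0 :: p) (0 :: iota 2 k)];
            [:: ASucc k.+2 1; ARel p [:: k.+3, k.+2 & iota 2 k];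
                ARel (1 :: p) [:: 0, k.+2, k.+3 & iota 2 k]]]
      :: rules f (0 :: p) ++ rules g (1 :: p)
  | RMu k f =>
      [:: Rule p k.+1
            [:: [:: AZero k.+1; ARel (0 :: p) [:: k.+1, 0 & iota 1 k];
                    ARel (1 :: p) (0 :: iota 1 k)]],
          Rule (1 :: p) k.+1
            [:: [:: AZero 0];
                [:: ASucc k.+1 0; ASucc k.+3 k.+2;
                    ARel (0 :: p) [:: k.+2, k.+1 & iota 1 k];
                    ARel (1 :: p) (k.+1 :: iota 1 k)]]
        & rules f (0 :: p)]
  end.

Lemma map_iota_nth T (x0 : T) (e : nat -> T) i (s : seq T) k :
  size s = k -> (forall j, j < k -> e (i + j) = nth x0 s j) ->
  map e (iota i k) = s.
Proof.
move=> <- es; apply: (@eq_from_nth _ x0); rewrite size_map size_iota// => j js.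
by rewrite (nth_map 0) ?size_iota// nth_iota// es.
Qed.

Lemma map_iota_shift T (x0 : T) (e : nat -> T) i s t k :
  size s = i -> size t = k ->
  (forall j, j < i + k -> e j = nth x0 (s ++ t) j) ->
  map e (iota i k) = t.
Proof.
move=> si tk es; apply: (map_iota_nth (x0 := x0) tk) => j jk.
by rewrite es ?ltn_add2l// nth_cat si ltnNge leq_addr/= addKn.
Qed.

Lemma size_cons_tuple T k (x : T) (t : k.-tuple T) : size (x :: t) = k.+1.
Proof. by rewrite /= size_tuple. Qed.

(** * Soundness: justified tuples are true computations *)

Section Soundness.
Variables (D : Type) (Z : D -> Prop) (S : D -> D -> Prop).
Variable Rel : label -> seq D -> Prop.
Variable rk : D -> nat.
Hypothesis rkZ : forall x, Z x -> rk x = 0.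
Hypothesis rkS : forall x y, S x y -> rk y = (rk x).+1.

Lemma rule_holds_nth r xs (x0 : D) : rule_holds Z S Rel r ->
  size xs = rarity r -> Rel (rlabel r) xs ->
  exists2 b, b \in rclauses r
    & exists2 e, (forall i, i < rarity r -> e i = nth x0 xs i)
               & clause_holds Z S Rel e b.
Proof.
move=> hr sxs; rewrite -{1}(mkseq_nth x0 xs) sxs => /hr[b br [e ee eb]].
by exists b => //; exists e.
Qed.

(** Induction on programs. Justifications might be circular in general, but recursion and
    minimisation pass to a point of smaller rank, so that an inner induction on [rk] unwinds
    them. *)
Lemma rules_sound k (c : recfun k) p :
  (forall r, r \in rules c p -> rule_holds Z S Rel r) ->
  forall y (xs : k.-tuple D), Rel p (y :: xs) -> rec_eval c (map_tuple rk xs) (rk y).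
Proof.
elim: c p => {k} [k||k i|k l f IHf g IHg|k f IHf g IHg|k f IHf] p hr y xs pyxs.
- have [b] := rule_holds_nth y (hr _ (mem_head _ _)) (size_cons_tuple y xs) pyxs.
  by rewrite inE => /eqP-> [e ee [/= /rkZ]]; rewrite ee.
- have [b] := rule_holds_nth y (hr _ (mem_head _ _)) (size_cons_tuple y xs) pyxs.
  rewrite inE => /eqP-> [e ee [/= /rkS]]; rewrite !ee//= => -> _.
  by rewrite /thead tnth_map (tnth_nth y).
- have [b] := rule_holds_nth y (hr _ (mem_head _ _)) (size_cons_tuple y xs) pyxs.
  rewrite inE => /eqP-> [e ee [/= ]]; rewrite !ee ?ltnS ?ltn_ord//= => -> _.
  by rewrite tnth_map (tnth_nth y).
- have [b] := rule_holds_nth y (hr _ (mem_head _ _)) (size_cons_tuple y xs) pyxs.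
  rewrite inE => /eqP-> [e ee [/= hf /clause_holdsP hg]].
  have exs : map e (iota 1 l) = xs.
    by apply: (map_iota_shift (s := [:: y]) (x0 := y)) => //; rewrite size_tuple.
  have sw : size (map e (iota l.+1 k)) == k by rewrite size_map size_iota.
  exists (map_tuple rk (Tuple sw)); split=> [i|].
    rewrite tnth_map (tnth_nth y)/= (nth_map 0) ?size_iota// nth_iota//.
    apply: (IHg i (i.+1 :: p)).
      move=> r ri; apply: hr; rewrite inE mem_cat; apply/orP; right.
      by apply/orP; right; apply/flatten_mapP; exists i => //; rewrite mem_enum.
    have /hg : ARel (i.+1 :: p) (l.+1 + i :: iota 1 l) \in
       [seq ARel (i.+1 :: p) (l.+1 + i :: iota 1 l) | i : 'I_k <- enum 'I_k].
      by apply/mapP; exists i; rewrite ?mem_enum.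
    by rewrite /= exs.
  apply: (IHf (0 :: p)).
    by move=> r ri; apply: hr; rewrite inE mem_cat ri orbT.
  by move: hf => /=; rewrite ee.
- have {}hr : [/\ rule_holds Z S Rel (head (Rule p 0 [::]) (rules (RPrec f g) p)),
     forall r, r \in rules f (0 :: p) -> rule_holds Z S Rel r
     & forall r, r \in rules g (1 :: p) -> rule_holds Z S Rel r].
    by split=> [|r ri|r ri]; apply: hr; rewrite inE ?eqxx// mem_cat ri !orbT.
  case: hr => hp /IHf{}IHf /IHg{}IHg.
  (* Strong induction on the rank of the recursion argument: the second clause refers to the same
     relation at a predecessor. *)
  have [N] := ubnP (rk (thead xs)); elim: N y xs pyxs => // N IHN y xs.
  case/tupleP: xs => n x pyxs; rewrite [thead _]tnth0 => nN.
  have -> : map_tuple rk [tuple of n :: x] = cons_tuple (rk n) (map_tuple rk x).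
    exact: val_inj.
  have [b] := rule_holds_nth y hp (size_cons_tuple y [tuple of n :: x]) pyxs.
  have ex e : (forall i, i < k.+2 -> e i = nth y [:: y, n & x] i) ->
      map e (iota 2 k) = x.
    move=> ee; apply: (map_iota_shift (s := [:: y; n]) (x0 := y)) => //.
    by rewrite size_tuple.
  rewrite !inE => /orP[]/eqP-> [e ee] /=; rewrite (ex _ ee) (ee 0)// (ee 1)//=.
    by move=> [/rkZ-> [/IHf fx _]]; apply/rec_eval_prec0.
  move=> [/rkS mn [pm [/(IHg _ (cons_tuple _ (cons_tuple _ x))) gx _]]].
  rewrite mn; apply/rec_eval_precS; exists (rk (e k.+3)); last first.
    rewrite [X in rec_eval g X](_ : _ =
      map_tuple rk (cons_tuple (e k.+2) (cons_tuple (e k.+3) x))) //.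
    exact: val_inj.
  have := IHN _ (cons_tuple (e k.+2) x) pm; rewrite [thead _]tnth0 -ltnS -mn.
  move=> /(_ nN); rewrite (_ : map_tuple rk _ = cons_tuple (rk (e k.+2)) (map_tuple rk x))//.
  exact: val_inj.
- have [b] := rule_holds_nth y (hr _ (mem_head _ _)) (size_cons_tuple y xs) pyxs.
  have {}IHf : forall y z (x : k.-tuple D), Rel (0 :: p) [:: y, z & x] ->
      rec_eval f (cons_tuple (rk z) (map_tuple rk x)) (rk y).
    move=> y' z x /(IHf (0 :: p) _ _ (cons_tuple z x)) h.
    rewrite (_ : cons_tuple _ _ = map_tuple rk (cons_tuple z x)); last exact: val_inj.
    by apply: h => r ri; apply: hr; rewrite !inE ri !orbT.
  have hp : rule_holds Z S Rel (nth (Rule p 0 [::]) (rules (RMu f) p) 1).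
    by apply: hr; rewrite !inE eqxx orbT.
  have exs z e : (forall i, i < k.+1 -> e i = nth z (z :: xs) i) ->
      map e (iota 1 k) = xs.
    move=> ee; apply: (map_iota_shift (s := [:: z]) (x0 := z)) => //.
    by rewrite size_tuple.
  rewrite inE => /eqP-> [e ee [/= /rkZ e0]]; rewrite (exs _ _ ee) (ee 0)//=.
  move=> [/IHf fy [py _]]; rewrite e0 in fy; split; first exact: fy.
  move: {e b ee e0} y {pyxs fy} py => y.
  (* Here [y] is the bound below which [f] must be positive; the auxiliary relation [1 :: p] is
     unwound by induction on its rank. *)
  have [N] := ubnP (rk y); elim: N y => // N IHN y yN.
  move=> /(rule_holds_nth y hp (size_cons_tuple y xs)).
  move=> [b]; rewrite !inE => /orP[]/eqP-> [e ee]/=.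
    by rewrite !ee// => -[/rkZ/= -> _].
  rewrite (exs _ _ ee) (ee 0)//= => -[/rkS ry [/rkS ru [/IHf fz [pz _]]]] z.
  (* Either [z] is the rank of the predecessor of [y], where the clause provides a successor as
     value, or it is smaller and the induction hypothesis applies. *)
  rewrite ry ltnS leq_eqVlt => /predU1P[->|zz].
    by exists (rk (e k.+3)); rewrite -ru.
  by apply: IHN pz _ zz; rewrite -ltnS -ry.
Qed.

End Soundness.

(** * Completeness: true computations lie in finite justified sets *)

Definition fact := (label * seq nat)%type.

Definition succ_rel (m n : nat) : Prop := n = m.+1.

Definition fact_rel (F : seq fact) (l : label) (s : seq nat) : Prop :=
  (l, s) \in F.

(** The bound [N] covers the existential variables of the clause as well, because every number used
    has to become a point of the finite picture. *)
Definition justified (Rs : seq rule) (N : nat) (F : seq fact) : Prop :=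
  forall f, f \in F -> exists2 r, r \in Rs
    & rlabel r = f.1 /\
      exists2 b, b \in rclauses r & exists e : nat -> nat,
        [/\ forall i, e i <= N, map e (iota 0 (rarity r)) = f.2
          & clause_holds (eq^~ 0) succ_rel (fact_rel F) e b].

Definition derivable (Rs : seq rule) (l : label) (s : seq nat) : Prop :=
  exists N F, justified Rs N F /\ fact_rel F l s.

Section Derivability.
Variable Rs : seq rule.

Lemma clause_holds_mono D Z S (R1 R2 : label -> seq D -> Prop) e b :
  (forall l s, R1 l s -> R2 l s) ->
  clause_holds Z S R1 e b -> clause_holds Z S R2 e b.
Proof.
move=> R12; elim: b => //= a b IHb [ha /IHb]; split=> //.
by case: a ha => //= l xs /R12.
Qed.

(** Clauses are monotone in the relations, so the reasons found in [F1] or in [F2] survive in the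
    union. *)
Lemma justifiedU N1 F1 N2 F2 : justified Rs N1 F1 -> justified Rs N2 F2 ->
  justified Rs (maxn N1 N2) (F1 ++ F2).
Proof.
move=> j1 j2 f; rewrite mem_cat.
move=> /orP[/j1|/j2] [r rRs [rf [b br [e [eN ef eb]]]]]; exists r => //;
  split=> //; exists b => //; exists e; split=> //.
- by move=> i; rewrite leq_max eN.
- by apply: clause_holds_mono eb => l s; rewrite /fact_rel mem_cat => ->.
- by move=> i; rewrite leq_max eN orbT.
- by apply: clause_holds_mono eb => l s; rewrite /fact_rel mem_cat orbC => ->.
Qed.

(** A clause has finitely many atoms, and the finite justified sets witnessing them can be
    united. *)
Lemma clause_holds_derivable e b :
  clause_holds (eq^~ 0) succ_rel (derivable Rs) e b ->
  exists N F, justified Rs N F /\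
              clause_holds (eq^~ 0) succ_rel (fact_rel F) e b.
Proof.
elim: b => [_|a b IHb /= [ha /IHb[N [F [jF Fb]]]]]; first by exists 0, [::].
case: a ha => [x|x y|x y|l xs] /= ha; try by exists N, F.
have [N' [F' [jF' F'l]]] := ha.
exists (maxn N' N), (F' ++ F); split; first exact: justifiedU.
split; first by rewrite /fact_rel mem_cat F'l.
by apply: clause_holds_mono Fb => l' s; rewrite /fact_rel mem_cat orbC => ->.
Qed.

Lemma derivable_rule r b (s : seq nat) : r \in Rs -> b \in rclauses r ->
  clause_holds (eq^~ 0) succ_rel (derivable Rs) (nth 0 s) b ->
  derivable Rs (rlabel r) (map (nth 0 s) (iota 0 (rarity r))).
Proof.
move=> rRs br /clause_holds_derivable[N [F [jF Fb]]].
set f := (rlabel r, map (nth 0 s) (iota 0 (rarity r))).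
(* The maximum of [s] bounds all values of [nth 0 s], the default 0 included. *)
exists (maxn N (\max_(x <- s) x)), (f :: F); split; last exact: mem_head.
have Ff l t : fact_rel F l t -> fact_rel (f :: F) l t.
  by rewrite /fact_rel inE orbC => ->.
move=> g; rewrite inE => /predU1P[->{g}|/jF].
  exists r => //; split=> //; exists b => //; exists (nth 0 s); split=> //.
    move=> i; rewrite leq_max; apply/orP; right.
    have [si|si] := leqP (size s) i; first by rewrite nth_default.
    by rewrite (big_nth 0) (bigD1_seq i) ?mem_index_iota ?iota_uniq//= leq_maxl.
  exact: clause_holds_mono Ff Fb.
move=> [r' r'Rs [rg [b' br' [e [eN eg eb]]]]]; exists r' => //; split=> //.
exists b' => //; exists e; split=> //; first by move=> i; rewrite leq_max eN.
exact: clause_holds_mono Ff eb.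
Qed.

(* [s] lists the values of all variables of the clause, arguments first. *)
Lemma derivable_rule_take r b args s : r \in Rs -> b \in rclauses r ->
  size args = rarity r ->
  clause_holds (eq^~ 0) succ_rel (derivable Rs) (nth 0 (args ++ s)) b ->
  derivable Rs (rlabel r) args.
Proof.
move=> rRs br sa /(derivable_rule rRs br); congr derivable.
apply: (map_iota_nth (x0 := 0) sa) => j ja.
by rewrite add0n nth_cat sa ja.
Qed.

Lemma map_nth_iota_cat (s1 s2 s3 s : seq nat) i k :
  s = s1 ++ s2 ++ s3 -> size s1 = i -> size s2 = k ->
  map (nth 0 s) (iota i k) = s2.
Proof.
move=> -> si sk; apply: (map_iota_nth (x0 := 0) sk) => j jk.
by rewrite nth_cat si ltnNge leq_addr/= addKn nth_cat sk jk.
Qed.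

(** Every step of an evaluation instantiates one rule. The list [s] given to [derivable_rule_take]
    holds the values of the existential variables, which are numbered after the arguments. *)
Lemma rules_complete k (c : recfun k) p v y :
  {subset rules c p <= Rs} -> rec_eval c v y -> derivable Rs p (y :: v).
Proof.
elim: c p v y => {k} [k||k i|k l f IHf g IHg|k f IHf g IHg|k f IHf] p v y sRs.
- have r0 := sRs _ (mem_head _ _).
  move=> /= ->; apply: (derivable_rule_take (s := [::]) r0 (mem_head _ _)).
    exact: size_cons_tuple.
  by [].
- have r0 := sRs _ (mem_head _ _).
  move=> /= ->; apply: (derivable_rule_take (s := [::]) r0 (mem_head _ _)).
    exact: size_cons_tuple.
  by split=> //=; rewrite cats0 /succ_rel /thead (tnth_nth 0).
- have r0 := sRs _ (mem_head _ _).
  move=> /= ->; apply: (derivable_rule_take (s := [::]) r0 (mem_head _ _)).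
    exact: size_cons_tuple.
  by split=> //=; rewrite cats0 (tnth_nth 0).
- have r0 := sRs _ (mem_head _ _).
  move=> /= [w [gw fw]]; apply: (derivable_rule_take (s := w) r0 (mem_head _ _)).
    exact: size_cons_tuple.
  have ev : map (nth 0 ((y :: v) ++ w)) (iota 1 l) = v.
    by apply: (@map_nth_iota_cat [:: y] _ w); rewrite ?size_tuple.
  have ew : map (nth 0 ((y :: v) ++ w)) (iota l.+1 k) = w.
    by apply: (@map_nth_iota_cat (y :: v) _ [::]);
      rewrite ?cats0 ?size_tuple ?size_cons_tuple.
  apply/clause_holdsP => a; rewrite inE => /predU1P[->|/mapP[i _ ->]].
    rewrite /= ew; apply: (IHf (0 :: p)) fw => r rf.
    by apply: sRs; rewrite inE mem_cat rf orbT.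
  rewrite /= ev.
  rewrite nth_cat size_tuple ltnNge leq_addr/= addKn -tnth_nth.
  apply: (IHg i (i.+1 :: p)) (gw i) => r ri; apply: sRs.
  rewrite inE mem_cat; apply/orP; right; apply/orP; right.
  by apply/flatten_mapP; exists i => //; rewrite mem_enum.
- have r0 := sRs _ (mem_head _ _).
  have {}IHf v' y' : rec_eval f v' y' -> derivable Rs (0 :: p) (y' :: v').
    by apply: IHf => r rf; apply: sRs; rewrite inE mem_cat rf orbT.
  have {}IHg v' y' : rec_eval g v' y' -> derivable Rs (1 :: p) (y' :: v').
    by apply: IHg => r rg; apply: sRs; rewrite inE mem_cat rg !orbT.
  case/tupleP: v => n x.
  elim: n y => [|n IHn] y.
    move=> /rec_eval_prec0/IHf fx.
    apply: (derivable_rule_take (s := [::]) r0 (mem_head _ _)).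
      by rewrite /= size_tuple.
    split=> //=; split=> //.
    rewrite (_ : map _ _ = x)//.
    by apply: (@map_nth_iota_cat [:: y; 0] _ [::]); rewrite ?size_tuple.
  move=> /rec_eval_precS[s /IHn ns /IHg gy].
  have b2 := mem_nth [::]
    (isT : 1 < size (rclauses (head (Rule p 0 [::]) (rules (RPrec f g) p)))).
  (* The variables [k.+2] and [k.+3] are the preceding recursion argument and the value there. *)
  apply: (derivable_rule_take (s := [:: n; s]) r0 b2).
    by rewrite /= size_tuple.
  set e := nth 0 _.
  have [] : [/\ e 0 = y, e 1 = n.+1, e k.+2 = n, e k.+3 = s & map e (iota 2 k) = x].
    split=> //; rewrite /e /=.
    - by rewrite nth_cat size_tuple ltnn subnn.
    - by rewrite nth_cat size_tuple ltnNge leqnSn/= subSnn.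
    - by apply: (@map_nth_iota_cat [:: y; n.+1] _ [:: n; s]); rewrite ?size_tuple.
  move: e => e e0 e1 en es ex.
  by rewrite /clause_holds/= ex e0 e1 en es.
- have r0 := sRs _ (mem_head _ _).
  have {}IHf z y' : rec_eval f (cons_tuple z v) y' ->
      derivable Rs (0 :: p) [:: y', z & v].
    by apply: IHf => r rf; apply: sRs; rewrite !inE rf !orbT.
  pose r1 := nth (Rule p 0 [::]) (rules (RMu f) p) 1.
  have r1Rs : r1 \in Rs by apply: sRs; rewrite !inE eqxx orbT.
  move=> /= [/IHf fy0 fz].
  have pz z : z <= y -> derivable Rs (1 :: p) (z :: v).
    elim: z => [_|z IHz zy].
      apply: (derivable_rule_take (s := [::]) r1Rs (mem_head _ _)) => //.
      exact: size_cons_tuple.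
    have [u /IHf fzu] := fz z zy.
    have b1 := mem_nth [::] (isT : 1 < size (rclauses r1)).
    (* In order: the predecessor of the bound, the positive value of [f] there, and the predecessor
       of that value. *)
    apply: (derivable_rule_take (s := [:: z; u.+1; u]) r1Rs b1).
      exact: size_cons_tuple.
    set e := nth 0 _.
    have [] : [/\ e 0 = z.+1, e k.+1 = z, e k.+2 = u.+1, e k.+3 = u & map e (iota 1 k) = v].
      split=> //; rewrite /e /=.
      - by rewrite nth_cat size_tuple ltnn subnn.
      - by rewrite nth_cat size_tuple ltnNge leqnSn/= subSnn.
      - by rewrite nth_cat size_tuple ltnNge ltnW//= -addn2 addKn.
      - by apply: (@map_nth_iota_cat [:: z.+1] _ [:: z; u.+1; u]); rewrite ?size_tuple.
    move: e => e e0 e1 e2 e3 ev.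
    rewrite /clause_holds/= ev e0 e1 e2 e3.
    by do 4![split=> //]; exact/IHz/ltnW.
  apply: (derivable_rule_take (s := [:: 0]) r0 (mem_head _ _)).
    exact: size_cons_tuple.
  set e := nth 0 _.
  have [] : [/\ e 0 = y, e k.+1 = 0 & map e (iota 1 k) = v].
    split=> //; rewrite /e /=.
    - by rewrite nth_cat size_tuple ltnn subnn.
    - by apply: (@map_nth_iota_cat [:: y] _ [:: 0]); rewrite ?size_tuple.
  move: e => e e0 e1 ev.
  rewrite /clause_holds/= ev e0 e1; do 2![split=> //].
  by split=> //; exact: pz.
Qed.

End Derivability.

(** * Distinct rules have distinct labels *)

Lemma rlabel_rules k (c : recfun k) p r :
  r \in rules c p -> exists q, rlabel r = q ++ p.
Proof.
elim: c p => {k} [k||k i|k l f IHf g IHg|k f IHf g IHg|k f IHf] p.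
1,2,3: by rewrite inE => /eqP->; exists [::].
all: rewrite /= !inE ?mem_cat.
- move=> /predU1P[->|/orP[/IHf[q ->]|/flatten_mapP[i _ /IHg[q ->]]]].
  + by exists [::].
  + by exists (rcons q 0); rewrite cat_rcons.
  + by exists (rcons q i.+1); rewrite cat_rcons.
- move=> /predU1P[->|/orP[/IHf[q ->]|/IHg[q ->]]].
  + by exists [::].
  + by exists (rcons q 0); rewrite cat_rcons.
  + by exists (rcons q 1); rewrite cat_rcons.
- move=> /predU1P[->|/predU1P[->|/IHf[q ->]]].
  + by exists [::].
  + by exists [:: 1].
  + by exists (rcons q 0); rewrite cat_rcons.
Qed.

(** The entry next to the common suffix [p] has a fixed distance from the end; it tells which
    immediate subprogram a label belongs to. *)
Lemma cat_cons_inj (T : Type) (q1 q2 p : seq T) x1 x2 :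
  q1 ++ x1 :: p = q2 ++ x2 :: p -> x1 = x2.
Proof.
move=> /(congr1 (fun s => nth x1 s (size s - (size p).+1))).
by rewrite !size_cat/= !addnK !nth_cat !ltnn !subnn.
Qed.

Lemma cat_cons_neq (T : Type) (q p : seq T) x : p <> q ++ x :: p.
Proof. by move=> /(congr1 size)/eqP; rewrite size_cat/= addnS ltn_eqF// ltnS leq_addl. Qed.

Lemma uniq_rlabel_cat (s1 s2 : seq rule) :
  uniq (map rlabel s1) -> uniq (map rlabel s2) ->
  (forall r1 r2, r1 \in s1 -> r2 \in s2 -> rlabel r1 <> rlabel r2) ->
  uniq (map rlabel (s1 ++ s2)).
Proof.
move=> u1 u2 s12; rewrite map_cat cat_uniq u1 u2 andbT; apply/hasPn => l.
move=> /mapP[r2 r2s ->]; apply/mapP => -[r1 r1s] /esym.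
exact: s12.
Qed.

(** A fact of a justified set has a reason by some rule with its label, whereas the sentence asserts
    every rule; uniqueness identifies the two rules. *)
Lemma uniq_rlabel_rules k (c : recfun k) p : uniq (map rlabel (rules c p)).
Proof.
elim: c p => {k} [k||k i|k l f IHf g IHg|k f IHf g IHg|k f IHf] p //.
- apply: (@uniq_rlabel_cat [:: _]) => //.
    apply: uniq_rlabel_cat => //; last first.
      move=> r1 r2 /rlabel_rules[q1 ->] /flatten_mapP[i _ /rlabel_rules[q2 ->]].
      by move=> e; have := cat_cons_inj e.
    elim: (enum _) (enum_uniq 'I_k) => //= i s IHs /andP[si us].
    apply: uniq_rlabel_cat => //; first exact: IHs.
    move=> r1 r2 /rlabel_rules[q1 ->] /flatten_mapP[j js /rlabel_rules[q2 ->]].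
    by move=> e; have [/val_inj ij] := cat_cons_inj e; rewrite ij js in si.
  move=> r1 r2; rewrite inE mem_cat => /eqP->.
  by move=> /orP[|/flatten_mapP[i _]] /rlabel_rules[q ->]; exact: cat_cons_neq.
- apply: (@uniq_rlabel_cat [:: _]) => //.
    apply: uniq_rlabel_cat => // r1 r2 /rlabel_rules[q1 ->] /rlabel_rules[q2 ->].
    by move=> e; have := cat_cons_inj e.
  move=> r1 r2; rewrite inE mem_cat => /eqP->.
  by move=> /orP[] /rlabel_rules[q ->]; exact: cat_cons_neq.
- apply: (@uniq_rlabel_cat [:: _; _]) => //.
    by rewrite /= inE andbT; apply/eqP; exact: (@cat_cons_neq _ [::]).
  move=> r1 r2; rewrite !inE => /orP[]/eqP-> /rlabel_rules[q ->] /=.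
    exact: cat_cons_neq.
  by move=> e; have := @cat_cons_inj _ [::] _ _ _ _ e.
Qed.

(** * First-order formulas *)

Section BetaPredicates.
Variables (M : structure) (O A B : M).

Definition zero_pt (v : M) : Prop :=
  forall u, P_rel u -> beta_rel O u v -> u = v.

Definition adj_pt (v w : M) : Prop :=
  [/\ P_rel v, beta_rel O v w, v <> w
    & forall u, P_rel u -> beta_rel v u w -> u = v \/ u = w].

(** The word as a graph: row [y] carries the letter [v] when the crossing point [q] is marked by
    [P]. *)
Definition letter (y v : M) : Prop :=
  [/\ P_rel y /\ P_rel v, beta_rel O y B, beta_rel O v A
    & exists q, [/\ P_rel q, beta_rel v q B & beta_rel y q A]].

Fixpoint spelled (y : M) (xs : seq M) : Prop :=
  match xs with
  | [::] => True
  | x :: xs => exists y', [/\ adj_pt y y', letter y' x & spelled y' xs]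
  end.

(** A tuple of the relation is a factor of the word: the letter [L] of the label, then the entries
    on consecutive rows. *)
Definition word_rel (L : M) (xs : seq M) : Prop :=
  exists2 y, letter y L & spelled y xs.

Fixpoint adj_iter n (v w : M) : Prop :=
  if n is n'.+1 then exists2 u, adj_pt v u & adj_iter n' u w else v = w.

End BetaPredicates.

Lemma upd_lt (T : Type) (rho : nat -> T) x y a :
  x < y -> [eta rho with y |-> a] x = rho x.
Proof. by move=> xy /=; rewrite ltn_eqF. Qed.

Lemma upd_eq (T : Type) (rho : nat -> T) x a : [eta rho with x |-> a] x = a.
Proof. by rewrite /= eqxx. Qed.

(* The variables 0, 1, 2 stand for the points O, A, B. In the next formulas
   the variables from [f] on are free for use. *)
Definition fZero f v := FAll f (FImp (FP f) (FImp (FBeta 0 f v) (FEq f v))).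

Definition fAdj f v w :=
  FAnd (FP v) (FAnd (FBeta 0 v w) (FAnd (FNot (FEq v w))
    (FAll f (FImp (FP f) (FImp (FBeta v f w) (FOr (FEq f v) (FEq f w))))))).

Definition fLetter f y v :=
  FAnd (FAnd (FP y) (FP v)) (FAnd (FBeta 0 y 2) (FAnd (FBeta 0 v 1)
    (FEx f (FAnd (FP f) (FAnd (FBeta v f 2) (FBeta y f 1)))))).

(* The variable [f] holds the current row. *)
Fixpoint fSpelled f (xs : seq nat) :=
  if xs is x :: xs then
    FEx f.+1 (FAnd (fAdj f.+2 f f.+1)
                   (FAnd (fLetter f.+2 f.+1 x) (fSpelled f.+1 xs)))
  else FEq f f.

Arguments fZero : simpl never.
Arguments fAdj : simpl never.
Arguments fLetter : simpl never.

Section Sat.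
Variable M : structure.
Implicit Types rho : nat -> M.

Lemma sat_fZero rho f v : 0 < f -> v < f ->
  sat rho (fZero f v) <-> zero_pt (rho 0) (rho v).
Proof. by move=> f0 vf; rewrite /fZero /= eqxx !ltn_eqF. Qed.

Lemma sat_fAdj rho f v w : 0 < f -> v < f -> w < f ->
  sat rho (fAdj f v w) <-> adj_pt (rho 0) (rho v) (rho w).
Proof.
move=> f0 vf wf; rewrite /fAdj /= eqxx !ltn_eqF//.
by split=> [[? [? []]]|[]].
Qed.

Lemma sat_fLetter rho f y v : 2 < f -> y < f -> v < f ->
  sat rho (fLetter f y v) <-> letter (rho 0) (rho 1) (rho 2) (rho y) (rho v).
Proof.
move=> f2 yf vf; rewrite /fLetter /= eqxx !ltn_eqF// 1?ltnW//.
split=> [[? [? [? [q [? []]]]]]|[? ? ? [q []]]].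
  by split=> //; exists q.
by split=> //; split=> //; split=> //; exists q.
Qed.

Lemma sat_fSpelled rho f xs : 2 < f -> all (gtn f) xs ->
  sat rho (fSpelled f xs) <->
  spelled (rho 0) (rho 1) (rho 2) (rho f) (map rho xs).
Proof.
elim: xs f rho => [|x xs IHxs] f rho f2 //= /andP[xf xsf].
have R_lt a z : z <= f -> [eta rho with f.+1 |-> a] z = rho z.
  by move=> zf; rewrite upd_lt.
have [f0 f1] : 0 < f /\ 1 < f by split; exact: leq_trans f2.
have f2' : 2 < f.+1 by exact: ltnW.
have [le0 le1 le2] : [/\ 0 <= f, 1 <= f & 2 <= f] by split=> //; exact: ltnW.
have IH a : sat [eta rho with f.+1 |-> a] (fSpelled f.+1 xs) <->
    spelled (rho 0) (rho 1) (rho 2) a (map rho xs).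
  rewrite IHxs//; last by apply: sub_all xsf => z /= /ltnW.
  rewrite upd_eq !R_lt// (_ : map _ xs = map rho xs)//.
  by apply/eq_in_map => z /(allP xsf) /ltnW; exact: R_lt.
have IHa a : sat [eta rho with f.+1 |-> a] (fAdj f.+2 f f.+1) <->
    adj_pt (rho 0) (rho f) a.
  by rewrite sat_fAdj// upd_eq !R_lt.
have IHl a : sat [eta rho with f.+1 |-> a] (fLetter f.+2 f.+1 x) <->
    letter (rho 0) (rho 1) (rho 2) a (rho x).
  rewrite sat_fLetter//; last by rewrite ltnS leqW// ltnW.
  by rewrite upd_eq !R_lt// ltnW.
split=> [[a [/IHa ? [/IHl ? /IH ?]]]|[a [ha hl hs]]]; exists a; first by [].
by split; [exact/IHa|split; [exact/IHl|exact/IH]].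
Qed.

Lemma sat_foldr_ex rho phi s :
  sat rho (foldr FEx phi s) <->
  exists2 rho', (forall x, x \notin s -> rho' x = rho x) & sat rho' phi.
Proof.
elim: s rho => [|x s IHs] rho /=.
  split=> [h|[rho' rr]]; first by exists rho.
  by have -> : rho' = rho by apply/funext => x; exact: rr.
split=> [[a /IHs[rho' rr h]]|[rho' rr h]].
  exists rho' => // y; rewrite inE negb_or => /andP[yx ys].
  by rewrite rr//= (negbTE yx).
exists (rho' x); apply/IHs; exists rho' => // y ys /=; case: eqP => [->//|/eqP yx].
by apply: rr; rewrite inE negb_or yx.
Qed.

Lemma sat_foldr_all rho phi s :
  sat rho (foldr FAll phi s) <->
  forall rho', (forall x, x \notin s -> rho' x = rho x) -> sat rho' phi.
Proof.
elim: s rho => [|x s IHs] rho /=.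
  split=> [h rho' rr|]; last exact.
  by have -> : rho' = rho by apply/funext => x; exact: rr.
split=> [h rho' rr|h a].
  have /IHs := h (rho' x); apply=> y ys /=; case: eqP => [->//|/eqP yx].
  by apply: rr; rewrite inE negb_or yx.
apply/IHs => rho' rr; apply: h => y; rewrite inE negb_or => /andP[yx ys].
by rewrite rr//= (negbTE yx).
Qed.

End Sat.

Definition fConj := foldr FAnd (FEq 0 0).
Definition fDisj := foldr FOr (FNot (FEq 0 0)).

Lemma sat_fConj (M : structure) (rho : nat -> M) (T : eqType) (F : T -> formula) s :
  sat rho (fConj (map F s)) <-> forall x, x \in s -> sat rho (F x).
Proof.
elim: s => [|a s IHs] //=; split=> [[ha /IHs hs] x|h].
  by rewrite inE => /predU1P[->|/hs].
by split; [apply: h; rewrite mem_head|apply/IHs => x xs; apply: h; rewrite inE xs orbT].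
Qed.

Lemma sat_fDisj (M : structure) (rho : nat -> M) (T : eqType) (F : T -> formula) s :
  sat rho (fDisj (map F s)) <-> exists2 x, x \in s & sat rho (F x).
Proof.
elim: s => [|a s IHs] /=; first by split=> [|[]].
split=> [[ha|/IHs[x xs hx]]|[x]].
- by exists a; rewrite ?mem_head.
- by exists x; rewrite ?inE ?xs ?orbT.
- rewrite inE => /predU1P[->|xs] hx; [by left|right].
  by apply/IHs; exists x.
Qed.

Definition atom_vars (a : atom) : seq nat :=
  match a with
  | AZero x => [:: x]
  | ASucc x y | AEq x y => [:: x; y]
  | ARel _ xs => xs
  end.

Definition rule_width (r : rule) : nat :=
  maxn (rarity r)
       (\max_(x <- flatten (map atom_vars (flatten (rclauses r)))) x.+1).

Lemma rule_widthP r b a : b \in rclauses r -> a \in b ->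
  all (gtn (rule_width r)) (atom_vars a).
Proof.
move=> br ab; apply/allP => x xa /=; rewrite /rule_width leq_max; apply/orP; right.
have xs : x \in flatten (map atom_vars (flatten (rclauses r))).
  apply/flatten_mapP; exists a => //; apply/flattenP; by exists b.
by rewrite (big_rem x)//= leq_maxl.
Qed.

(** * Formulas for rules *)

Section RuleFormula.
Variable labs : seq label.

(** A label outside [labs] has index [size labs], so the variables from 3 to [3 + size labs] are
    reserved; hence the 4 in [vbase]. *)
Definition vLabel (l : label) := 3 + index l labs.
(* The rule variable [i] becomes the variable [vbase + i]. *)
Definition vbase := 4 + size labs.

Lemma vLabel_base l : vLabel l < vbase.
Proof. by rewrite /vLabel /vbase -addnS leq_add2l ltnS index_size. Qed.

Definition fRel f l xs := FEx f (FAnd (fLetter f.+1 f (vLabel l)) (fSpelled f xs)).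

Definition fAtom f (a : atom) : formula :=
  match a with
  | AZero x => fZero f (vbase + x)
  | ASucc x y => fAdj f (vbase + x) (vbase + y)
  | AEq x y => FEq (vbase + x) (vbase + y)
  | ARel l xs => fRel f l (map (addn vbase) xs)
  end.

Definition fRule (r : rule) : formula :=
  let f := vbase + rule_width r in
  foldr FAll
    (FImp (fRel f (rlabel r) (iota vbase (rarity r)))
       (fDisj [seq foldr FEx (fConj (map (fAtom f) b))
                     (iota (vbase + rarity r) (rule_width r - rarity r))
              | b <- rclauses r]))
    (iota vbase (rarity r)).

Variable M : structure.
Implicit Types rho : nat -> M.

Definition rho_rel rho (l : label) (xs : seq M) :=
  word_rel (rho 0) (rho 1) (rho 2) (rho (vLabel l)) xs.

Lemma eq_rho_rel rho rho' :
  (forall x, x < vbase -> rho' x = rho x) -> rho_rel rho' = rho_rel rho.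
Proof.
move=> rr; apply/funext => l; apply/funext => xs.
by rewrite /rho_rel !rr// vLabel_base.
Qed.

Lemma sat_fRel rho f l xs : vbase <= f -> all (gtn f) xs ->
  sat rho (fRel f l xs) <-> rho_rel rho l (map rho xs).
Proof.
move=> bf xsf; have f2 : 2 < f by exact: leq_trans bf.
have lf : vLabel l < f by exact: leq_trans (vLabel_base l) _.
have f0 : 0 < f by exact: leq_trans f2.
have f1 : 1 < f by exact: leq_trans f2.
have R_lt a z : z < f -> [eta rho with f |-> a] z = rho z by exact: upd_lt.
have IHl y : sat [eta rho with f |-> y] (fLetter f.+1 f (vLabel l)) <->
    letter (rho 0) (rho 1) (rho 2) y (rho (vLabel l)).
  by rewrite sat_fLetter// 1?ltnW// upd_eq !R_lt.
have IHs y : sat [eta rho with f |-> y] (fSpelled f xs) <->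
    spelled (rho 0) (rho 1) (rho 2) y (map rho xs).
  rewrite sat_fSpelled// upd_eq !R_lt// (_ : map _ xs = map rho xs)//.
  by apply/eq_in_map => z /(allP xsf); exact: R_lt.
split=> [[y [/IHl ? /IHs ?]]|[y ? ?]]; first by exists y.
by exists y; split; [exact/IHl|exact/IHs].
Qed.

Lemma sat_fAtom rho f a : all (fun x => vbase + x < f) (atom_vars a) -> vbase <= f ->
  sat rho (fAtom f a) <->
  atom_holds (zero_pt (rho 0)) (adj_pt (rho 0)) (rho_rel rho)
             (fun i => rho (vbase + i)) a.
Proof.
move=> + bf; have f0 : 0 < f by exact: leq_trans bf.
case: a => [x|x y|x y|l xs] /=; rewrite ?andbT.
- by move=> xf; have := sat_fZero rho f0 xf.
- by move=> /andP[xf yf]; have := sat_fAdj rho f0 xf yf.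
- by [].
- move=> xf; have xf' : all (gtn f) (map (addn vbase) xs) by rewrite all_map.
  by have := sat_fRel rho l bf xf'; rewrite -map_comp.
Qed.

Lemma eq_atom_holds D Z S (Rl : label -> seq D -> Prop) e e' a :
  {in atom_vars a, e =1 e'} -> atom_holds Z S Rl e a <-> atom_holds Z S Rl e' a.
Proof.
case: a => [x|x y|x y|l xs] /= ee; rewrite -?ee ?inE ?eqxx ?orbT//.
by rewrite (_ : map e xs = map e' xs)//; apply/eq_in_map.
Qed.

Lemma sat_fRule rho r :
  sat rho (fRule r) <->
  rule_holds (zero_pt (rho 0)) (adj_pt (rho 0)) (rho_rel rho) r.
Proof.
set a := rarity r; set w := rule_width r.
have aw : a <= w by exact: leq_maxl.
have iotaf : all (gtn (vbase + w)) (iota vbase a).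
  apply/allP => z; rewrite mem_iota /= => /andP[_ /leq_trans]; apply.
  by rewrite leq_add2l.
have map_e rho' : map rho' (iota vbase a) = map (fun i => rho' (vbase + i)) (iota 0 a).
  by rewrite -{1}[vbase]addn0 iotaDl -map_comp.
rewrite /fRule sat_foldr_all -/a -/w; split=> [h e Rle|h rho' rr].
  (* The values of [e] are placed on the argument variables, where the universal quantifiers of the
     formula read them. *)
  pose rho' x := if vbase <= x < vbase + a then e (x - vbase) else rho x.
  have rr : forall x, x < vbase -> rho' x = rho x by move=> x xb; rewrite /rho' leqNgt xb.
  have re i : i < a -> rho' (vbase + i) = e i.
    by move=> ia; rewrite /rho' leq_addr ltn_add2l ia addKn.
  have r_off x : x \notin iota vbase a -> rho' x = rho x.
    by rewrite mem_iota /rho' => /negbTE ->.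
  have rel' : sat rho' (fRel (vbase + w) (rlabel r) (iota vbase a)).
    apply/sat_fRel; rewrite ?leq_addr// (@eq_rho_rel rho)// map_e.
    rewrite (_ : map _ _ = map e (iota 0 a))//; apply/eq_in_map => i.
    by rewrite mem_iota => /andP[_]; exact: re.
  have /sat_fDisj[b br /sat_foldr_ex[rho2 rr2 /sat_fConj bh]] := h rho' r_off rel'.
  have r2 x : x < vbase + a -> rho2 x = rho' x.
    by move=> xb; apply: rr2; rewrite mem_iota leqNgt xb.
  have r2b x : x < vbase -> rho2 x = rho x.
    by move=> xb; rewrite r2 ?rr// ltn_addr.
  exists b => //; exists (fun i => rho2 (vbase + i)) => [i ia|].
    by rewrite r2 ?ltn_add2l// re.
  apply/clause_holdsP => c cb; rewrite -(@eq_rho_rel rho rho2)// -(r2b 0)//.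
  apply/(sat_fAtom _ (f := vbase + w)); rewrite ?leq_addr//; last exact: bh.
  by apply: sub_all (rule_widthP br cb) => x; rewrite /= ltn_add2l.
have rb x : x < vbase -> rho' x = rho x.
  by move=> xb; apply: rr; rewrite mem_iota leqNgt xb.
move=> /(@sat_fRel rho' (vbase + w) _ _ (leq_addr _ _) iotaf).
rewrite (@eq_rho_rel rho)// map_e => /h[b br [e ee /clause_holdsP bh]].
apply/sat_fDisj; exists b => //; apply/sat_foldr_ex.
(* The witnesses of the clause are placed on the existential variables; on the arguments [e] agrees
   with [rho'] already. *)
pose rho2 x := if vbase + a <= x < vbase + w then e (x - vbase) else rho' x.
have r2b x : x < vbase -> rho2 x = rho x.
  by move=> xb; rewrite /rho2 leqNgt ltn_addr//= rb.
have r2e i : i < w -> rho2 (vbase + i) = e i.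
  move=> iw; rewrite /rho2 leq_add2l ltn_add2l iw andbT addKn.
  by case: leqP => // /ee.
exists rho2 => [x|].
  by rewrite mem_iota -addnA subnKC// /rho2 => /negbTE->.
apply/sat_fConj => c cb; have cw := rule_widthP br cb.
apply/sat_fAtom; rewrite ?leq_addr//.
  by apply: sub_all cw => x; rewrite /= ltn_add2l.
rewrite (@eq_rho_rel rho)// r2b//; apply/(@eq_atom_holds _ _ _ _ _ e); last exact: bh.
by move=> x /(allP cw); exact: r2e.
Qed.

End RuleFormula.

(** * The sentence attached to a number *)

Section Sentence.
Variables (labs : seq label) (Rs : seq rule) (root : label).
Let b := vbase labs.

(** The root fact lists the output first: the value is zero on the first input [b] and some second
    input [b.+2]. *)
Definition fQuery : formula :=
  FEx b.+1 (FAnd (fZero b.+3 b.+1)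
    (FEx b.+2 (fRel labs b.+3 root [:: b.+1; b; b.+2]))).

(** Replaces the point in [b] by its successor, reusing the same variables each time. Thus [n]
    enters the sentence only as a number of iterations, and the variables stay bounded independently
    of [n]. *)
Definition fStep (phi : formula) : formula :=
  FEx b.+1 (FAnd (fAdj b.+2 b b.+1) (FEx b (FAnd (FEq b b.+1) phi))).

Definition fMain (n : nat) : formula :=
  FAnd (fConj (map (fRule labs) Rs))
    (FEx b (FAnd (fZero b.+1 b) (iter n fStep fQuery))).

Definition var_bound : nat :=
  b + 5 + \max_(x <- free_vars fQuery ++ free_vars (fConj (map (fRule labs) Rs))) x.

(** The existential closure chooses O, A, B and the letters of the labels; its negation says that no
    picture of a computation with output zero exists. *)
Definition fSentence (n : nat) : formula :=
  FNot (foldr FEx (fMain n) (iota 0 var_bound)).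

Lemma free_vars_foldr_ex phi s :
  free_vars (foldr FEx phi s) = [seq x <- free_vars phi | x \notin s].
Proof.
elim: s => [|x s IHs] /=; first by rewrite filter_predT.
by rewrite IHs -filter_predI; apply: eq_filter => y; rewrite /= inE negb_or.
Qed.

Lemma all_free_ex (p : pred nat) x phi :
  all p (free_vars phi) -> all p (free_vars (FEx x phi)).
Proof. by move=> /allP h; apply/allP => y; rewrite mem_filter => /andP[_ /h]. Qed.

Lemma all_free_all (p : pred nat) x phi :
  all p (free_vars phi) -> all p (free_vars (FAll x phi)).
Proof. exact: (@all_free_ex p x). Qed.

Lemma all_free_and (p : pred nat) phi psi : all p (free_vars phi) -> all p (free_vars psi) ->
  all p (free_vars (FAnd phi psi)).
Proof. by move=> h1 h2; rewrite all_cat h1. Qed.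

Lemma all_free_fZero (p : pred nat) f v :
  p 0 -> p v -> p f -> all p (free_vars (fZero f v)).
Proof. by move=> p0 pv pf; apply: all_free_all; rewrite /= p0 pv pf. Qed.

Lemma all_free_fAdj (p : pred nat) f v w :
  p 0 -> p v -> p w -> p f -> all p (free_vars (fAdj f v w)).
Proof.
move=> p0 pv pw pf; do 3!(apply: all_free_and; first by rewrite /= ?p0 ?pv ?pw).
by apply: all_free_all; rewrite /= pv pw pf.
Qed.

Lemma all_free_iter (p : pred nat) n : p 0 -> (forall i, i < 3 -> p (b + i)) ->
  all p (free_vars fQuery) -> all p (free_vars (iter n fStep fQuery)).
Proof.
move=> p0 pb pQ; have pb0 : p b by rewrite -[b]addn0 pb.
have pb1 : p b.+1 by rewrite -addn1 pb.
have pb2 : p b.+2 by rewrite -addn2 pb.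
elim: n => [|n IHn]; first exact: pQ.
rewrite iterS; apply: all_free_ex; apply: all_free_and; first exact: all_free_fAdj.
by apply: all_free_ex; apply: all_free_and => //; rewrite /= pb0 pb1.
Qed.

Lemma var_boundP : all (gtn var_bound)
  (free_vars fQuery ++ free_vars (fConj (map (fRule labs) Rs))).
Proof.
apply/allP => x xs; rewrite -[gtn _ _]/(x < var_bound).
apply: (@leq_ltn_trans (\max_(x <- free_vars fQuery ++
    free_vars (fConj (map (fRule labs) Rs))) x)).
  exact: leq_bigmax_seq.
by rewrite /var_bound -[X in X < _]add0n ltn_add2r addnS.
Qed.

Lemma sentence_fSentence n : sentence (fSentence n).
Proof.
have bB i : i < 3 -> gtn var_bound (b + i).
  by move=> i3; rewrite /= /var_bound ltn_addr// ltn_add2l ltnW// ltnW.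
have b0 : gtn var_bound 0 by apply: leq_trans (bB 0 isT); rewrite ltnS.
have := var_boundP; rewrite all_cat => /andP[bq br].
have bM : all (gtn var_bound) (free_vars (fMain n)).
  apply: all_free_and br _; apply: all_free_ex; apply: all_free_and.
    apply: all_free_fZero => //; first by rewrite -[b]addn0 bB.
    by rewrite -addn1 bB.
  exact: all_free_iter.
apply/eqP; rewrite (_ : free_vars _ =
  free_vars (foldr FEx (fMain n) (iota 0 var_bound)))// free_vars_foldr_ex.
apply/eqP; rewrite -size_eq0 size_filter eqn0Ngt -has_count.
by apply/hasPn => x /(allP bM) xB; rewrite mem_iota negbK /= add0n.
Qed.

Variable M : structure.
Implicit Types rho : nat -> M.

Lemma models_fSentence n :
  models M (fSentence n) <-> forall rho, ~ sat rho (fMain n).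
Proof.
have closed rho : sat rho (fSentence n) <->
    ~ sat rho (foldr FEx (fMain n) (iota 0 var_bound)) by [].
split=> [h rho hn|h rho].
  by have /closed := h rho; apply; apply/sat_foldr_ex; exists rho.
by apply/closed => /sat_foldr_ex[rho' _]; exact: h.
Qed.

(** A step moves the value of [b] to an adjacent point and leaves the variables below [b] alone,
    hence also O, A, B and the letters of the labels. *)
Lemma sat_iter_fStep rho n :
  sat rho (iter n fStep fQuery) <->
  exists2 v, adj_iter (rho 0) n (rho b) v
    & exists z y, zero_pt (rho 0) z /\ rho_rel labs rho root [:: z; v; y].
Proof.
elim: n rho => [|n IHn] rho.
  pose r1 z := [eta rho with b.+1 |-> z].
  pose r2 z y := [eta r1 z with b.+2 |-> y].
  have r1E z x : x < b.+1 -> r1 z x = rho x by exact: upd_lt.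
  have r2E z y x : x < b.+1 -> r2 z y x = rho x.
    by move=> xb; rewrite /r2 upd_lt ?r1E// leqW.
  have zz z : sat (r1 z) (fZero b.+3 b.+1) <-> zero_pt (rho 0) z.
    by rewrite sat_fZero// r1E// /r1 upd_eq.
  have zy z y : sat (r2 z y) (fRel labs b.+3 root [:: b.+1; b; b.+2]) <->
      rho_rel labs rho root [:: z; rho b; y].
    have <- : map (r2 z y) [:: b.+1; b; b.+2] = [:: z; rho b; y].
      congr [:: _; _; _]; last exact: upd_eq.
        by rewrite /r2 upd_lt// /r1 upd_eq.
      exact: r2E.
    rewrite sat_fRel ?(@eq_rho_rel _ _ rho)//.
    - by move=> x xb; rewrite r2E// ltnW.
    - by rewrite ltnW// ltnW.
    - by rewrite /= !ltnS leqnn leqnSn leqW.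
  split=> [[z [/zz z0 [y /zy h]]]|[_ <- [z [y [z0 h]]]]].
    by exists (rho b) => //; exists z, y.
  by exists z; split; [exact/zz|exists y; exact/zy].
pose r1 w := [eta rho with b.+1 |-> w].
pose r2 w v := [eta r1 w with b |-> v].
have r2E w v x : x < b -> r2 w v x = rho x.
  by move=> xb; rewrite /r2 upd_lt// /r1 upd_lt// ltnW.
have wa w : sat (r1 w) (fAdj b.+2 b b.+1) <-> adj_pt (rho 0) (rho b) w.
  by rewrite sat_fAdj// /r1 upd_eq !upd_lt.
have IH w v : sat (r2 w v) (iter n fStep fQuery) <->
    exists2 u, adj_iter (rho 0) n v u
    & exists z y, zero_pt (rho 0) z /\ rho_rel labs rho root [:: z; u; y].
  by rewrite IHn (eq_rho_rel (r2E _ _)) (r2E _ _ 0)// /r2 upd_eq.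
have eqw w v : sat (r2 w v) (FEq b b.+1) <-> v = w.
  rewrite -[sat _ _]/(r2 w v b = r2 w v b.+1) /r2 upd_eq.
  by rewrite [X in v = X](_ : _ = w)//= gtn_eqF// eqxx.
have step : sat rho (iter n.+1 fStep fQuery) <->
  exists w, sat (r1 w) (fAdj b.+2 b b.+1) /\
    exists v, sat (r2 w v) (FEq b b.+1) /\ sat (r2 w v) (iter n fStep fQuery) by [].
rewrite step; split=> [[w [/wa ha [v [/eqw-> /IH[u hu hq]]]]]|[u [w ha hu] hq]].
  by exists u => //; exists w.
exists w; split; first exact/wa.
by exists w; split; [exact/eqw|apply/IH; exists u].
Qed.

Lemma sat_fMain rho n :
  sat rho (fMain n) <->
  (forall r, r \in Rs ->
     rule_holds (zero_pt (rho 0)) (adj_pt (rho 0)) (rho_rel labs rho) r) /\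
  exists v0 v z y, [/\ zero_pt (rho 0) v0, adj_iter (rho 0) n v0 v,
    zero_pt (rho 0) z & rho_rel labs rho root [:: z; v; y]].
Proof.
have zz v : sat [eta rho with b |-> v] (fZero b.+1 b) <-> zero_pt (rho 0) v.
  by rewrite sat_fZero// upd_eq upd_lt.
have hQ v : sat [eta rho with b |-> v] (iter n fStep fQuery) <->
    exists2 u, adj_iter (rho 0) n v u
    & exists z y, zero_pt (rho 0) z /\ rho_rel labs rho root [:: z; u; y].
  rewrite sat_iter_fStep upd_eq upd_lt// (@eq_rho_rel _ _ rho) => [//|x xb].
  exact: upd_lt.
split=> [[/sat_fConj hR [v0 [/zz h0 /hQ[v hv [z [y [hz hy]]]]]]]|].
  split; last by exists v0, v, z, y.
  by move=> r /hR/sat_fRule.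
move=> [hR [v0 [v [z [y [h0 hv hz hy]]]]]]; split.
  by apply/sat_fConj => r /hR hr; apply/sat_fRule.
by exists v0; split; [exact/zz|apply/hQ; exists v => //; exists z, y].
Qed.

End Sentence.

(** * Computability of the Gödel code of the sentence *)

Definition code3 a m n : nat := CodeSeq.code [:: a; m; n].

Lemma computable_code2 a k (F : k.-tuple nat -> nat) :
  computable F -> computable (fun v => CodeSeq.code [:: a; F v]).
Proof.
move=> cF; apply: (@computable_code_cons k (fun=> a)); first exact: computable_const.
by apply: (computable_code_cons cF); exact: computable_const.
Qed.

Lemma computable_code3 a k (F G : k.-tuple nat -> nat) :
  computable F -> computable G -> computable (fun v => code3 a (F v) (G v)).
Proof.
move=> cF cG; apply: (@computable_code_cons k (fun=> a)); first exact: computable_const.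
apply: (computable_code_cons cF).
by apply: (computable_code_cons cG); exact: computable_const.
Qed.

Lemma godel_code_and phi psi :
  godel_code (FAnd phi psi) = code3 4 (godel_code phi) (godel_code psi).
Proof. by []. Qed.

Lemma godel_code_ex x phi : godel_code (FEx x phi) = code3 8 x (godel_code phi).
Proof. by []. Qed.

Lemma computable1_godel_and phi F : computable1 (fun n => godel_code (F n)) ->
  computable1 (fun n => godel_code (FAnd phi (F n))).
Proof.
exact: (@computable_code3 4 1 (fun=> godel_code phi) (fun v => godel_code (F (thead v)))
  (computable_const _ _)).
Qed.

Lemma computable1_godel_ex x F : computable1 (fun n => godel_code (F n)) ->
  computable1 (fun n => godel_code (FEx x (F n))).
Proof.
exact: (@computable_code3 8 1 (fun=> x) (fun v => godel_code (F (thead v)))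
  (computable_const _ _)).
Qed.

Lemma computable1_godel_not F : computable1 (fun n => godel_code (F n)) ->
  computable1 (fun n => godel_code (FNot (F n))).
Proof. exact: (@computable_code2 3 1 (fun v => godel_code (F (thead v)))). Qed.

(** [F] acts on codes through the computable [G], so primitive recursion on numbers suffices and no
    formula has to be decoded. *)
Lemma computable1_godel_iter F G phi : computable1 G ->
  (forall psi, godel_code (F psi) = G (godel_code psi)) ->
  computable1 (fun n => godel_code (iter n F phi)).
Proof.
move=> cG FG; rewrite (_ : (fun n => _) = fun n => iter n G (godel_code phi)).
  exact: computable1_iter.
by apply/funext; elim=> // n IHn; rewrite !iterS FG IHn.
Qed.

Lemma computable1_fSentence labs Rs root :
  computable1 (fun n => godel_code (fSentence labs Rs root n)).
Proof.
have cE F s : computable1 (fun n => godel_code (F n)) ->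
    computable1 (fun n => godel_code (foldr FEx (F n) s)).
  by move=> cF; elim: s => // x s; exact: computable1_godel_ex.
apply/computable1_godel_not/cE/computable1_godel_and/computable1_godel_ex.
apply: computable1_godel_and.
(* [G] is the effect of [fStep] on codes; everything in it except [m] is constant. *)
pose b := vbase labs; pose G m := code3 8 b.+1 (code3 4 (godel_code (fAdj b.+2 b b.+1))
  (code3 8 b (code3 4 (godel_code (FEq b b.+1)) m))).
apply: (@computable1_godel_iter _ G) => [|phi]; last first.
  by rewrite /fStep !godel_code_ex !godel_code_and godel_code_ex godel_code_and.
have cC k m : computable (fun _ : k.-tuple nat => m) := computable_const k m.
do 4!(apply: computable_code3; first exact: cC).
exact: (computable_proj (ord0 : 'I_1)).
Qed.

(** * Euclidean betweenness *)

Import Order.TTheory GRing.Theory Num.Theory.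
Import numFieldNormedType.Exports.
Local Open Scope classical_set_scope.
Local Open Scope ring_scope.

Section Euclid.
Variables (R : realType) (n : nat).
Implicit Types (s t u v w : 'rV[R]_n).

Definition dot u v : R := (u *m v^T) 0 0.
Definition enorm v : R := Num.sqrt (dot v v).

Lemma dotC u v : dot u v = dot v u.
Proof. by rewrite /dot !mxE; apply: eq_bigr => i _; rewrite !mxE mulrC. Qed.

Lemma dotDl u v w : dot (u + v) w = dot u w + dot v w.
Proof. by rewrite /dot mulmxDl mxE. Qed.

Lemma dotZl a u v : dot (a *: u) v = a * dot u v.
Proof. by rewrite /dot -scalemxAl mxE. Qed.

Lemma dotDr u v w : dot w (u + v) = dot w u + dot w v.
Proof. by rewrite dotC dotDl !(dotC w). Qed.

Lemma dotZr a u v : dot u (a *: v) = a * dot u v.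
Proof. by rewrite dotC dotZl dotC. Qed.

Lemma dotE v : dot v v = \sum_i v 0 i ^+ 2.
Proof. by rewrite /dot mxE; apply: eq_bigr => i _; rewrite mxE. Qed.

Lemma dot_ge0 v : 0 <= dot v v.
Proof. by rewrite dotE sumr_ge0// => i _; exact: sqr_ge0. Qed.

Lemma sqr_enorm v : enorm v ^+ 2 = dot v v.
Proof. by rewrite sqr_sqrtr ?dot_ge0. Qed.

Lemma enorm_ge0 v : 0 <= enorm v.
Proof. exact: sqrtr_ge0. Qed.

Lemma enorm0_eq0 v : enorm v = 0 -> v = 0.
Proof.
move=> v0; have : dot v v = 0 by rewrite -sqr_enorm v0 expr0n.
rewrite dotE => /psumr_eq0P h; apply/rowP => i; rewrite mxE.
by apply/eqP; rewrite -sqrf_eq0 h// => j _; exact: sqr_ge0.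
Qed.

Lemma enormZ a v : enorm (a *: v) = `|a| * enorm v.
Proof.
by rewrite /enorm dotZl dotZr mulrA -expr2 sqrtrM ?sqr_ge0// sqrtr_sqr.
Qed.

Lemma dot_comb a b u v : dot (a *: u + b *: v) (a *: u + b *: v) =
  a ^+ 2 * dot u u + 2 * a * b * dot u v + b ^+ 2 * dot v v.
Proof. by rewrite dotDl !dotDr !dotZl !dotZr (dotC v u); ring. Qed.

Lemma dotD u v : dot (u + v) (u + v) = dot u u + 2 * dot u v + dot v v.
Proof. by have := dot_comb 1 1 u v; rewrite !scale1r => ->; ring. Qed.

(** Equality case of the triangle inequality: squaring gives [dot u v = enorm u * enorm v], and then
    the difference of the two sides has norm 0. *)
Lemma enormD_eq u v : enorm (u + v) = enorm u + enorm v ->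
  enorm v *: u = enorm u *: v.
Proof.
move=> uv; apply/eqP; rewrite -subr_eq0 -scaleNr; apply/eqP/enorm0_eq0.
have /eqP := congr1 (fun x => x ^+ 2) uv.
rewrite sqr_enorm dotD sqrrD !sqr_enorm -mulr_natl => /eqP duv.
have {}duv : dot u v = enorm u * enorm v by lra.
rewrite /enorm dot_comb -!/(enorm _) -2!sqr_enorm duv.
by rewrite (_ : _ + _ = 0) ?sqrtr0//; ring.
Qed.

Lemma enormD_le u v : enorm (u + v) <= enorm u + enorm v.
Proof.
have uv0 : 0 <= enorm u + enorm v by rewrite addr_ge0 ?enorm_ge0.
rewrite -(@ler_pXn2r _ 2) ?nnegrE ?enorm_ge0// sqr_enorm dotD sqrrD !sqr_enorm.
rewrite lerD2r lerD2l -[leRHS]mulr_natl ler_pM2l//.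
have [u0|u0] := eqVneq (enorm u) 0.
  by rewrite u0 mul0r (enorm0_eq0 u0) -(scale0r 0) dotZl mul0r.
have [v0|v0] := eqVneq (enorm v) 0.
  by rewrite v0 mulr0 (enorm0_eq0 v0) -(scale0r 0) dotZr mul0r.
(* Cauchy-Schwarz, from the nonnegative squared norm of this vector. *)
have := dot_ge0 (enorm v *: u + (- enorm u) *: v).
rewrite dot_comb -!sqr_enorm.
set a := enorm u in u0 *; set b := enorm v in v0 *.
have a0 : 0 < a by rewrite lt_def u0 enorm_ge0.
have b0 : 0 < b by rewrite lt_def v0 enorm_ge0.
rewrite (_ : _ + _ = (2 * (a * b)) * (a * b - dot u v)); last by ring.
by rewrite pmulr_rge0 ?subr_ge0// !mulr_gt0.
Qed.

Lemma euclid_distE s t : euclid_dist s t = enorm (t - s).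
Proof.
rewrite /euclid_dist /enorm dotE; congr Num.sqrt; apply: eq_bigr => i _.
by rewrite !mxE -sqrrN opprB.
Qed.

(** The equality case of the triangle inequality makes [t - s] and [u - t] parallel; the parameter
    is the ratio of [enorm (t - s)] to the whole length. *)
Lemma betwP s t u : betw s t u <->
  exists2 l, 0 <= l <= 1 & t = s + l *: (u - s).
Proof.
rewrite /betw !euclid_distE.
split=> [h|[l /andP[l0 l1] ->]]; last first.
  have -> : s + l *: (u - s) - s = l *: (u - s) by rewrite addrC addKr.
  rewrite enormZ ger0_norm//.
  have -> : u - (s + l *: (u - s)) = (1 - l) *: (u - s).
    by rewrite scalerBl scale1r opprD addrA.
  by rewrite enormZ ger0_norm ?subr_ge0//; ring.
have us : (t - s) + (u - t) = u - s by rewrite addrC subrKA.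
have := @enormD_eq (t - s) (u - t).
rewrite us => /(_ h); set a := enorm (t - s) in h *; set b := enorm (u - t) in h *.
move=> bats; have a0 : 0 <= a := enorm_ge0 _; have b0 : 0 <= b := enorm_ge0 _.
have [ab0|ab0] := eqVneq (a + b) 0.
  exists 0; rewrite ?lexx ?ler01// scale0r addr0.
  by apply/eqP; rewrite -subr_eq0; apply/eqP/enorm0_eq0; rewrite -/a; lra.
have ab : 0 < a + b by rewrite lt_def ab0 addr_ge0.
exists (a / (a + b)).
  by rewrite divr_ge0 ?addr_ge0//= ler_pdivrMr// mul1r lerDl.
apply: (addIr (- s)); rewrite [RHS]addrC addKr.
apply: (scalerI ab0); rewrite scalerA mulrCA divff// mulr1.
by rewrite scalerDl bats -us [RHS]scalerDr.
Qed.

Lemma betw_trans o u v w : betw o v w -> betw o u v -> betw o u w.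
Proof.
move=> /betwP[l /andP[l0 l1] ->] /betwP[m /andP[m0 m1] ->]; apply/betwP.
exists (m * l); last by rewrite [o + l *: _]addrC addrK scalerA.
by rewrite mulr_ge0//= mulr_ile1.
Qed.

Lemma betw_split o u v w : betw o v w -> betw o u w -> betw o u v \/ betw v u w.
Proof.
move=> /betwP[l /andP[l0 l1] vE] /betwP[m /andP[m0 m1] uE].
have [ml|lm] := leP m l.
  left; apply/betwP; have [l00|l00] := eqVneq l 0.
    have m00 : m = 0 by lra.
    by exists 0; rewrite ?lexx ?ler01// uE m00 !scale0r.
  have lp : 0 < l by rewrite lt_def l00.
  exists (m / l); first by rewrite divr_ge0//= ler_pdivrMr// mul1r.
  by rewrite uE vE [o + l *: _]addrC addrK scalerA divfK.
right; apply/betwP; exists ((m - l) / (1 - l)).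
  have l1' : 0 < 1 - l by lra.
  by rewrite divr_ge0 ?subr_ge0 ?(ltW lm)//= ler_pdivrMr// mul1r lerD2r.
have -> : w - v = (1 - l) *: (w - o) by rewrite vE scalerBl scale1r opprD addrA.
rewrite scalerA divfK ?lt0r_neq0//; last by lra.
by rewrite uE vE scalerBl -addrA [l *: _ + _]addrC subrK.
Qed.

Lemma betw_anti o v w : betw o v w -> betw o w v -> v = w.
Proof.
move=> /betwP[l /andP[l0 l1] vE] /betwP[m /andP[m0 m1] wE].
have [wo|wo] := eqVneq (w - o) 0; first
  by rewrite vE wo scaler0 addr0 -[w](subrK o) wo add0r.
have : (1 - m * l) *: (w - o) = 0.
  rewrite scalerBl scale1r -scalerA; apply/eqP; rewrite subr_eq0; apply/eqP.
  by rewrite {1}wE addrC addKr {1}vE [o + _]addrC addrK.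
move=> /eqP; rewrite scaler_eq0 (negbTE wo) orbF subr_eq0 => /eqP ml.
have l_1 : l = 1.
  apply/eqP; rewrite eq_le l1 /= ml -[leRHS]mul1r ler_wpM2r//.
by rewrite vE l_1 scale1r addrC subrK.
Qed.

End Euclid.

(** The rank of [v] counts the points of [P] between [O] and [v] other than [v]. Passing to an
    adjacent [w] adds exactly [v], because points of a segment starting at [O] are comparable. *)
Lemma finite_rank (R : realType) n (T P : set 'rV[R]_n)
    (O : betw_structure T P) : P `<=` T -> finite_set P ->
  exists rk : betw_structure T P -> nat,
    (forall v, zero_pt O v -> rk v = 0%N) /\
    (forall v w, adj_pt O v w -> rk w = (rk v).+1).
Proof.
move=> PT /finite_seqP[s0 sP]; pose s := undup s0.
have mem_s u : u \in s <-> P u by rewrite mem_undup sP.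
pose rk (v : set_type T) := count (fun u => `[< betw (val O) u (val v) /\ u <> val v >]) s.
have inT u : P u -> exists u' : set_type T, val u' = u.
  by move=> /PT/mem_set Tu; exists (SigSub Tu).
exists rk; split=> [v vO|v w [Pv Ovw vw vwP]].
  apply/eqP; rewrite -leqn0 leqNgt -has_count; apply/hasPn => u /mem_s Pu.
  apply/asboolPn => -[Ouv]; apply; have [u' uu'] := inT u Pu.
  by rewrite -uu'; congr val; apply: vO => /=; rewrite uu'.
have -> : rk w = count (predU (fun u => `[< betw (val O) u (val v) /\ u <> val v >])
                        (pred1 (val v))) s.
  apply: eq_in_count => u /mem_s Pu; apply/asboolP/orP.
    move=> [Ouw uw]; have [->|/eqP uv] := eqVneq u (val v).
      by right => /=; rewrite eqxx.
    left; apply/asboolP; split=> //.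
    have [//|vuw] := betw_split Ovw Ouw.
    have [u' uu'] := inT u Pu.
    have [uE|uE] : u' = v \/ u' = w by apply: vwP; rewrite /= uu'.
      by rewrite -uu' uE in uv.
    by rewrite -uu' uE in uw.
  move=> [/asboolP[Ouv uv]|/eqP ->].
    split; first exact: betw_trans Ovw Ouv.
    by move=> uw; apply: vw; apply/val_inj; apply: (betw_anti Ovw); rewrite -uw.
  by split=> // /val_inj.
rewrite -[LHS]addn0 -[X in (_ + X)%N](count_pred0 s) (@eq_count _ pred0 (predI
  (fun u => `[< betw (val O) u (val v) /\ u <> val v >]) (pred1 (val v)))).
  rewrite count_predUI count_uniq_mem ?undup_uniq//.
  by rewrite (_ : val v \in s) ?addn1//; apply/mem_s.
by move=> u /=; apply/esym/negP => /andP[/asboolP[_ +] /eqP].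
Qed.

(** * Projective coordinates and the grid *)

Section Row3.
Variable R : realType.

Definition row3 (x y z : R) : 'rV[R]_3 := \row_i nth 0 [:: x; y; z] i.

Lemma row3_comb a b x y z x' y' z' :
  a *: row3 x y z + b *: row3 x' y' z' =
  row3 (a * x + b * x') (a * y + b * y') (a * z + b * z').
Proof. by apply/rowP => -[[|[|[|]]]]// ?; rewrite !mxE. Qed.

Lemma row3_inj x y z x' y' z' : row3 x y z = row3 x' y' z' ->
  [/\ x = x', y = y' & z = z'].
Proof.
move=> e; have h i := congr1 (fun v : 'rV_3 => v 0 i) e.
split; first by have := h ord0; rewrite !mxE.
  by have := h (@Ordinal 3 1 isT); rewrite !mxE.
by have := h (@Ordinal 3 2 isT); rewrite !mxE.
Qed.

Lemma row3E (a : 'rV[R]_3) :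
  a = row3 (a 0 ord0) (a 0 (@Ordinal 3 1 isT)) (a 0 (@Ordinal 3 2 isT)).
Proof. by apply/rowP => -[[|[|[|]]]]// ?; rewrite mxE /=; congr (a _ _); exact/val_inj. Qed.

End Row3.

Section ProjectiveCoordinates.
Variables (R : realType) (n : nat) (Q : 'M[R]_(3, n)) (om : 'cV[R]_3).
Implicit Types a b c : 'rV[R]_3.

(** The linear form whose zeros are the points at infinity of the chart [proj]. *)
Definition wt a : R := (a *m om) 0 0.

(* The point of the plane with homogeneous coordinates [a] relative to the
   triangle whose vertices, scaled by the weights [om], are the rows of [Q] *)
Definition proj a : 'rV[R]_n := (wt a)^-1 *: (a *m Q).

(** Injectivity of the map sending [a] to the pair of [wt a] and [a *m Q]: the vertices are affinely
    independent when the weights are nonzero. *)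
Hypothesis indep : forall a, wt a = 0 -> a *m Q = 0 -> a = 0.

Lemma wtD a b : wt (a + b) = wt a + wt b.
Proof. by rewrite /wt mulmxDl mxE. Qed.

Lemma wtZ k a : wt (k *: a) = k * wt a.
Proof. by rewrite /wt -scalemxAl mxE. Qed.

(** Rescaling by the weights turns an affine relation between points into a linear one between
    coordinates. Both sides then have the same weight, so [indep] applies to their difference. *)
Lemma proj_affine a b c l : wt a != 0 -> wt b != 0 -> wt c != 0 ->
  proj b = proj a + l *: (proj c - proj a) <->
  b = (wt b * (1 - l) / wt a) *: a + (wt b * l / wt c) *: c.
Proof.
move=> a0 b0 c0.
have projE : proj a + l *: (proj c - proj a) =
    (wt b)^-1 *: (((wt b * (1 - l) / wt a) *: a + (wt b * l / wt c) *: c) *m Q).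
  rewrite /proj mulmxDl -!scalemxAl; move: (a *m Q) (c *m Q) => aQ cQ.
  by apply/rowP => i; rewrite !mxE; field; rewrite a0 b0 c0.
have wtE : wt ((wt b * (1 - l) / wt a) *: a + (wt b * l / wt c) *: c) = wt b.
  by rewrite wtD !wtZ !divfK// -mulrDr subrK mulr1.
rewrite projE; split=> [|->]; last by rewrite {1}/proj wtE.
move=> /(scalerI (invr_neq0 b0)) bQ; apply/eqP; rewrite -subr_eq0.
apply/eqP/indep; last by rewrite mulmxBl bQ subrr.
by rewrite -scaleN1r wtD wtZ wtE mulN1r subrr.
Qed.

Lemma proj_comb a b c k l : wt a != 0 -> wt b != 0 -> wt c != 0 ->
  b = k *: a + l *: c ->
  proj b = proj a + (l * wt c / wt b) *: (proj c - proj a).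
Proof.
move=> a0 b0 c0 bE; apply/proj_affine => //.
have kE : wt b * (1 - l * wt c / wt b) = k * wt a.
  rewrite mulrBr mulr1 mulrCA mulfV// mulr1 {1}bE wtD !wtZ; exact: addrK.
rewrite kE mulfK// mulrCA mulfV// mulr1 mulfK//.
Qed.

(** For positive weights a segment is the image of the cone spanned by the coordinates of its ends,
    a description free of [Q] and [om]. *)
Lemma betw_proj a b c : 0 < wt a -> 0 < wt b -> 0 < wt c ->
  betw (proj a) (proj b) (proj c) <->
  exists k l, [/\ 0 <= k, 0 <= l & b = k *: a + l *: c].
Proof.
move=> a0 b0 c0; have [[a0' b0'] c0'] := (lt0r_neq0 a0, lt0r_neq0 b0, lt0r_neq0 c0).
split=> [/betwP[l /andP[l0 l1] bE]|[k [l [k0 l0 bE]]]].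
  have /(proj_affine l a0' b0' c0') {}bE := bE.
  exists (wt b * (1 - l) / wt a), (wt b * l / wt c); split; last exact: bE.
    by rewrite divr_ge0 ?mulr_ge0 ?subr_ge0// ltW.
  by rewrite divr_ge0 ?mulr_ge0// ltW.
apply/betwP; exists (l * wt c / wt b); last exact: proj_comb bE.
rewrite divr_ge0 ?mulr_ge0 ?(ltW c0) ?(ltW b0)//= ler_pdivrMr// mul1r bE wtD !wtZ.
by rewrite lerDr mulr_ge0// ltW.
Qed.

End ProjectiveCoordinates.

(** * Lines in linearly complete and linearly closed sets *)

Section Lines.
Variables (R : realType) (n : nat).
Implicit Types (s t u y z : 'rV[R]_n) (S U : set 'rV[R]_n).

Definition on_line s t z : Prop := exists l, z = s + l *: (t - s).

Definition trace_line U s t : set 'rV[R]_n := [set z | U z /\ on_line s t z].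

Lemma betw_param s d (l1 l2 l3 : R) : (l1 <= l2 <= l3) || (l3 <= l2 <= l1) ->
  betw (s + l1 *: d) (s + l2 *: d) (s + l3 *: d).
Proof.
move=> h; rewrite /betw !euclid_distE.
have dE (l m : R) : s + l *: d - (s + m *: d) = (l - m) *: d.
  by apply/rowP => i; rewrite !mxE; ring.
rewrite !dE !enormZ -mulrDl; congr (_ * _).
case/orP: h => /andP[h1 h2].
  by rewrite !ger0_norm ?subr_ge0//; [ring|exact: le_trans h2].
by rewrite !ler0_norm ?subr_le0//; [ring|exact: le_trans h2].
Qed.

Lemma on_line_trans s t y z u :
  on_line s t y -> on_line s t z -> on_line y z u -> on_line s t u.
Proof.
move=> [l ->] [m ->] [k ->]; exists (l + k * (m - l)).
by apply/rowP => i; rewrite !mxE; ring.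
Qed.

Lemma on_line_swap s t y z : on_line s t y -> on_line s t z -> y != z ->
  on_line y z t.
Proof.
move=> [l ->] [m ->] ne.
have ml : m - l != 0.
  by apply: contra_neq ne => /subr0_eq ->.
by exists ((1 - l) / (m - l)); apply/rowP => i; rewrite !mxE; field.
Qed.

Lemma is_line_trace U s t : U s -> U t -> s != t -> is_line U (trace_line U s t).
Proof.
move=> Us Ut st; split=> [u []//||u v w [_ [l1 ->]] [_ [l2 ->]] [_ [l3 ->]]|].
- exists s, t; split=> //; split=> //.
    by exists 0; rewrite scale0r addr0.
  by exists 1; rewrite scale1r addrC subrK.
- have [l12|/ltW l12] := leP l1 l2; have [l23|/ltW l23] := leP l2 l3;
    have [l13|/ltW l13] := leP l1 l3.
  + by apply: Or31; apply: betw_param; rewrite l12 l23.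
  + by apply: Or31; apply: betw_param; rewrite l12 l23.
  + by apply: Or32; apply: betw_param; rewrite l13 l23.
  + by apply: Or33; apply: betw_param; rewrite l12 l13 orbT.
  + by apply: Or33; apply: betw_param; rewrite l12 l13.
  + by apply: Or32; apply: betw_param; rewrite l13 l23 orbT.
  + by apply: Or31; apply: betw_param; rewrite l12 l23 orbT.
  + by apply: Or31; apply: betw_param; rewrite l12 l23 orbT.
- move=> y z u [_ ys] [_ zs] yz Uu h; split=> //.
  apply: (on_line_trans ys zs).
  case: h => /betwP[l _ uE]; first by exists l.
  have l0 : l != 0.
    by apply: contra_neq yz => l0; rewrite uE l0 scale0r addr0.
  exists l^-1; rewrite uE.
  by apply/rowP => i; rewrite !mxE; field.
Qed.

(** Linear completeness, read on parameters: points of [S] on the line approximate the point with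
    parameter [m]. *)
Lemma dense_param S s t (m e : R) : linearly_complete S -> S s -> S t ->
  s != t -> 0 < e -> exists2 l, `|l - m| < e & S (s + l *: (t - s)).
Proof.
move=> Sc Ss St st e0.
have [i ti] : exists i, (t - s) 0 i != 0.
  apply/existsP; rewrite -negb_forall; apply: contra st => /forallP h.
  apply/eqP/esym/subr0_eq/rowP => i; rewrite [RHS]mxE; exact/eqP/h.
have Lz : trace_line [set: 'rV[R]_n] s t (s + m *: (t - s)) by split=> //; exists m.
have : closure (trace_line S s t) (s + m *: (t - s)).
  apply: Sc Lz; [exact: is_line_trace|exact: is_line_trace|].
  by move=> z [_ zst]; split.
(* The ball is for the sup norm; at a coordinate [i] where [s] and [t] differ, this radius bounds
   the error of the parameter by [e]. *)
have r0 : 0 < e * `|(t - s) 0 i| by rewrite mulr_gt0// normr_gt0.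
move=> /(_ _ (nbhsx_ballx _ _ r0))[q [[Sq [l qE]] [_ /(_ 0 i)]]].
rewrite qE -ball_normE /= => bq; exists l; last by rewrite -qE.
have {bq} : `|(m - l) * (t - s) 0 i| < e * `|(t - s) 0 i|.
  by move: bq; congr (`|_| < _); rewrite !mxE; ring.
by rewrite normrM ltr_pM2r ?normr_gt0// distrC.
Qed.

(** Linear closedness yields some common point [y] of the two lines in [S]; if [y] were not [z], the
    lines would share two points and coincide. *)
Lemma line_meet S s1 t1 s2 t2 z : linearly_closed S ->
  S s1 -> S t1 -> S s2 -> S t2 -> s1 != t1 -> s2 != t2 ->
  on_line s1 t1 z -> on_line s2 t2 z -> ~ on_line s1 t1 t2 -> S z.
Proof.
move=> Scl S1 S1' S2 S2' st1 st2 z1 z2 n2.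
have sub s t : trace_line S s t `<=` trace_line [set: 'rV[R]_n] s t by move=> u [].
have on_t s t : on_line s t t by exists 1; rewrite scale1r addrC subrK.
have L12 : trace_line S s1 t1 <> trace_line S s2 t2.
  by move=> L12; apply: n2; have [] : trace_line S s1 t1 t2 by rewrite L12.
have lineT s t st := @is_line_trace setT s t I I st.
have meet0 : trace_line setT s1 t1 `&` trace_line setT s2 t2 !=set0 by exists z.
have [y [[Sy y1] [_ y2]]] := Scl _ _ _ _ (is_line_trace S1 S1' st1)
  (is_line_trace S2 S2' st2) L12 (lineT _ _ st1) (lineT _ _ st2) (sub _ _) (sub _ _) meet0.
have [<-//|yz] := eqVneq y z.
by case: n2; apply: on_line_trans (on_line_swap y2 z2 yz).
Qed.

End Lines.

(** * Constructing the grid by intersecting lines *)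

Section Grid.
Variables (R : realType) (n : nat) (Q : 'M[R]_(3, n)) (om : 'cV[R]_3).
Variable S : set 'rV[R]_n.
Hypothesis indep : forall a, wt om a = 0 -> a *m Q = 0 -> a = 0.
Hypothesis om_gt0 : forall i, 0 < om i 0.
Hypothesis Scl : linearly_closed S.

Let E i j k := proj Q om (row3 i j k).

Lemma wt_row3_gt0 (i j k : R) : 0 <= i -> 0 <= j -> 0 <= k -> 0 < i + j + k ->
  0 < wt om (row3 i j k).
Proof.
move=> i0 j0 k0 ijk; rewrite /wt mxE !big_ord_recl big_ord0 !mxE/= addr0.
move: (om_gt0 ord0) (om_gt0 (lift ord0 ord0)) (om_gt0 (lift ord0 (lift ord0 ord0))).
move: (om _ _) (om _ _) (om _ _) => z y x x0 y0 z0.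
have [ix jy kz] : [/\ 0 <= i * x, 0 <= j * y & 0 <= k * z].
  by split; apply: mulr_ge0 => //; exact: ltW.
have [i00|i0'] := eqVneq i 0; last first.
  by apply: ltr_pwDl; [rewrite mulr_gt0// lt_def i0'|exact: addr_ge0].
have [j00|j0'] := eqVneq j 0; last first.
  apply: ltr_wpDl => //; apply: ltr_pwDl => //.
  by rewrite mulr_gt0// lt_def j0'.
by rewrite i00 j00 !mul0r !add0r mulr_gt0//; move: ijk; rewrite i00 j00 !add0r.
Qed.

(** [line_meet] in homogeneous coordinates: [b] lies on two lines because it is a combination of two
    pairs. *)
Lemma proj_meet (a1 c1 a2 c2 b : 'rV[R]_3) (k1 l1 k2 l2 : R) :
  0 < wt om a1 -> 0 < wt om c1 -> 0 < wt om a2 -> 0 < wt om c2 -> 0 < wt om b ->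
  S (proj Q om a1) -> S (proj Q om c1) -> S (proj Q om a2) -> S (proj Q om c2) ->
  b = k1 *: a1 + l1 *: c1 -> b = k2 *: a2 + l2 *: c2 ->
  (forall k l, c2 <> k *: a1 + l *: c1) ->
  (forall k, c1 <> k *: a1) -> (forall k, c2 <> k *: a2) ->
  S (proj Q om b).
Proof.
move=> /lt0r_neq0 A1 /lt0r_neq0 C1 /lt0r_neq0 A2 /lt0r_neq0 C2 /lt0r_neq0 B.
move=> Sa1 Sc1 Sa2 Sc2 b1 b2 n12 n1 n2.
have neq a c : wt om a != 0 -> wt om c != 0 -> (forall k, c <> k *: a) ->
    proj Q om a != proj Q om c.
  move=> A C nac; apply/eqP => ac.
  have /(proj_affine indep _ A C C) : proj Q om c =
      proj Q om a + 0 *: (proj Q om c - proj Q om a) by rewrite scale0r addr0.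
  by rewrite mulr0 mul0r scale0r addr0 => /nac.
apply: (line_meet Scl Sa1 Sc1 Sa2 Sc2); [exact: neq|exact: neq| | |].
- by eexists; exact: proj_comb b1.
- by eexists; exact: proj_comb b2.
- by move=> [l /(proj_affine indep _ A1 C2 C1) /n12].
Qed.

Lemma row3Z (a x y z : R) : a *: row3 x y z = row3 (a * x) (a * y) (a * z).
Proof. by apply/rowP => -[[|[|[|]]]]// ?; rewrite !mxE. Qed.

Hypothesis S100 : S (E 1 0 0).
Hypothesis S010 : S (E 0 1 0).
Hypothesis S001 : S (E 0 0 1).
Hypothesis S111 : S (E 1 1 1).

Ltac meet_side := first
  [ exact: S100 | exact: S010 | exact: S001 | exact: S111 | assumption
  | apply: wt_row3_gt0; lra
  | by rewrite row3_comb; congr row3; ring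
  | by move=> k l; rewrite row3_comb => /row3_inj[]; nra
  | by move=> k; rewrite row3Z => /row3_inj[]; nra ].

(** The line from a vertex through the unit point meets the opposite side here. *)
Lemma grid011 : S (E 0 1 1).
Proof.
by apply: (@proj_meet (row3 1 0 0) (row3 1 1 1) (row3 0 1 0) (row3 0 0 1) _ (-1) 1 1 1);
  meet_side.
Qed.

Lemma grid110 : S (E 1 1 0).
Proof.
by apply: (@proj_meet (row3 0 0 1) (row3 1 1 1) (row3 1 0 0) (row3 0 1 0) _ (-1) 1 1 1);
  meet_side.
Qed.

Lemma grid101 : S (E 1 0 1).
Proof.
by apply: (@proj_meet (row3 0 1 0) (row3 1 1 1) (row3 1 0 0) (row3 0 0 1) _ (-1) 1 1 1);
  meet_side.
Qed.

(** With first coordinate 1 as affine chart: the line of slope 1 through (x, 0) meets the horizontal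
    line at height 1 in (x + 1, 1), which is projected vertically to the axis. *)
Lemma grid_x x : 0 <= x -> S (E 1 x 0) -> S (E 1 (x + 1) 0).
Proof.
move=> x0 Sx; have := grid101; have := grid011; rewrite /E => S011 S101.
have Sx1 : S (E 1 (x + 1) 1).
  by apply: (@proj_meet (row3 1 x 0) (row3 0 1 1) (row3 0 1 0) (row3 1 0 1) _
    1 1 (x + 1) 1); meet_side.
by apply: (@proj_meet (row3 0 0 1) (row3 1 (x + 1) 1) (row3 1 0 0) (row3 0 1 0) _
  (-1) 1 1 (x + 1)); meet_side.
Qed.

Lemma grid_y y : 0 <= y -> S (E 1 0 y) -> S (E 1 0 (y + 1)).
Proof.
move=> y0 Sy; have := grid110; have := grid011; rewrite /E => S011 S110.
have Sy1 : S (E 1 1 (y + 1)).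
  by apply: (@proj_meet (row3 1 0 y) (row3 0 1 1) (row3 0 0 1) (row3 1 1 0) _
    1 1 (y + 1) 1); meet_side.
by apply: (@proj_meet (row3 0 1 0) (row3 1 1 (y + 1)) (row3 1 0 0) (row3 0 0 1) _
  (-1) 1 1 (y + 1)); meet_side.
Qed.

Lemma grid_nat i j : S (E 1 i%:R j%:R).
Proof.
have Sx : S (E 1 i%:R 0).
  by elim: i => // i IHi; rewrite -natr1; exact: grid_x.
have Sy : S (E 1 0 j%:R).
  by elim: j => // j IHj; rewrite -natr1; exact: grid_y.
have : 0 <= i%:R :> R by []; have : 0 <= j%:R :> R by [].
move: {i j} (i%:R) (j%:R) Sx Sy => x y; rewrite /E => Sx Sy y0 x0.
by apply: (@proj_meet (row3 1 x 0) (row3 0 0 1) (row3 1 0 y) (row3 0 1 0) _ 1 y 1 x);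
  meet_side.
Qed.

End Grid.

(** * A frame whose grid lies in T *)

Lemma row3_mul (R : realType) n (a0 a1 a2 : R) (q0 q1 q2 : 'rV[R]_n) :
  row3 a0 a1 a2 *m (\matrix_(i < 3) nth 0 [:: q0; q1; q2] i) =
  a0 *: q0 + a1 *: q1 + a2 *: q2.
Proof.
by apply/rowP => j; rewrite !mxE !big_ord_recl big_ord0 !mxE/= addr0 addrA.
Qed.

(** [S] lies in no line, so it contains [s] and [t] not collinear with [x]; density of parameters
    moves both towards [x] without leaving their rays. *)
Lemma exists_triangle (R : realType) n (S : set 'rV[R]_n) x (e : R) :
  (0 < n)%N -> linearly_regular_flat 2 S -> S x -> 0 < e ->
  exists p1 p2, [/\ S p1, S p2, euclid_dist x p1 < e, euclid_dist x p2 < e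
    & forall c1 c2, c1 *: (p1 - x) + c2 *: (p2 - x) = 0 -> c1 = 0 /\ c2 = 0].
Proof.
move=> n0 [_ _ S1 Sc _] Sx e0.
have line_flat (v : 'rV[R]_n) : v != 0 -> ~ (S `<=` [set x + r *m v | r in [set: 'rV[R]_1]]).
  move=> v0; apply: (S1 1%N _ erefl); exists x, v; split=> //.
  by rewrite /row_free rank_rV v0.
have [s Ss xs] : exists2 s, S s & x != s.
  apply: contrapT => h.
  (* If [S] were only [x], it would lie in a line through [x] of any direction, such as this one. *)
  have v0 : const_mx 1 != 0 :> 'rV[R]_n.
    by apply/eqP => /rowP/(_ (Ordinal n0)); rewrite !mxE => /eqP; rewrite oner_eq0.
  apply: (line_flat _ v0) => s Ss; exists 0 => //; rewrite mul0mx addr0.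
  by apply: contrapT => /eqP xs; apply: h; exists s.
have sx0 : s - x != 0 by rewrite subr_eq0 eq_sym.
have [t St tl] : exists2 t, S t & ~ on_line x s t.
  apply: contrapT => h; apply: (line_flat _ sx0) => t St.
  have [l ->] : on_line x s t by apply: contrapT => tl; apply: h; exists t.
  by exists l%:M => //; rewrite mul_scalar_mx.
have xt : x != t.
  by apply/eqP => xt; apply: tl; exists 0; rewrite scale0r addr0.
have near u : S u -> x != u -> exists l, [/\ 0 < l, S (x + l *: (u - x))
    & euclid_dist x (x + l *: (u - x)) < e].
  move=> Su xu; set k := enorm (u - x); have k0 : 0 <= k := enorm_ge0 _.
  have k1 : 0 < k + 1 by rewrite ltr_wpDl.
  have d0 : 0 < e / (2 * (k + 1)) by rewrite divr_gt0 ?mulr_gt0.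
  (* Target and tolerance are equal, so [l] is positive and below [e / (k + 1)]. *)
  have [l ld Sl] := dense_param (e / (2 * (k + 1))) Sc Sx Su xu d0.
  move: ld; rewrite ltr_norml => /andP[l1 l2].
  have l0 : 0 < l by move: l1; lra.
  exists l; split=> //; rewrite euclid_distE [x + _]addrC addrK enormZ gtr0_norm//.
  rewrite -/k; apply: (@le_lt_trans _ _ (2 * (e / (2 * (k + 1))) * k)).
    by rewrite ler_wpM2r//; lra.
  rewrite (_ : _ * k = (e * k) / (k + 1)); last by field; rewrite lt0r_neq0.
  by rewrite ltr_pdivrMr// ltr_pM2l//; lra.
have [l1 [l10 S1' e1]] := near s Ss xs; have [l2 [l20 S2' e2]] := near t St xt.
exists (x + l1 *: (s - x)), (x + l2 *: (t - x)); split=> // c1 c2.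
rewrite ![x + _]addrC !addrK !scalerA => h.
have c20 : c2 = 0.
  apply: contrapT => /eqP c2n; apply: tl.
  have cl : c2 * l2 != 0 by rewrite mulf_neq0// lt0r_neq0.
  exists (- (c1 * l1) / (c2 * l2)); apply: (addIr (- x)).
  rewrite [RHS]addrC addKr; apply: (scalerI cl).
  rewrite scalerA mulrCA mulfV// mulr1 scaleNr; apply/eqP.
  by rewrite -subr_eq0 opprK addrC h.
split=> //; move: h; rewrite c20 mul0r scale0r addr0 => /eqP.
by rewrite scaler_eq0 (negbTE sx0) orbF mulf_eq0 (gt_eqF l10) orbF => /eqP.
Qed.

(* The weights are the barycentric coordinates of an interior point of the
   triangle, which is therefore the unit point (1 : 1 : 1). *)
Lemma exists_frame (R : realType) n (T : set 'rV[R]_n) :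
  (0 < n)%N -> extends_linearly_in_2D T ->
  exists (Q : 'M[R]_(3, n)) (om : 'cV[R]_3),
    [/\ forall a, wt om a = 0 -> a *m Q = 0 -> a = 0,
        forall i, 0 < om i 0,
        T (proj Q om (row3 1 0 0)),
        T (proj Q om (row3 0 1 0)) /\ T (proj Q om (row3 0 0 1))
      & forall i j, T (proj Q om (row3 1 i%:R j%:R))].
Proof.
move=> n0 [S [e [x [Sreg e0 [Sx Tx] ST]]]].
have [p1 [p2 [Sp1 Sp2 e1 e2 ind]]] := exists_triangle n0 Sreg Sx e0.
have [_ _ _ Sc Scl] := Sreg.
have half0 : 0 < 1 / 2 :> R by lra.
have p12 : p1 != p2.
  apply/eqP => p12; have [] := ind 1 (-1).
    by rewrite p12 scaleN1r scale1r subrr.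
  by move=> /eqP; rewrite oner_eq0.
(* A point [q] inside the side from [p1] to [p2], and then a point between [x] and [q], give an
   interior point of the triangle in [S]. *)
have [a ah Sq] := dense_param (1 / 2) Sc Sp1 Sp2 p12 half0.
have {ah} [a0 a1] : 0 < a /\ a < 1.
  by move: ah; rewrite ltr_norml => /andP[]; split; lra.
set q := p1 + _ in Sq.
have qE : q - x = (1 - a) *: (p1 - x) + a *: (p2 - x).
  by apply/rowP => i; rewrite !mxE; ring.
have xq : x != q.
  apply/eqP => xq; have := qE; rewrite -xq subrr => /esym/ind[_] a00.
  by rewrite a00 ltxx in a0.
have [b bh Su] := dense_param (1 / 2) Sc Sx Sq xq half0.
have {bh} [b0 b1] : 0 < b /\ b < 1.
  by move: bh; rewrite ltr_norml => /andP[]; split; lra.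
pose w0 := 1 - b; pose w1 := b * (1 - a); pose w2 := b * a.
have [w00 w10 w20] : [/\ 0 < w0, 0 < w1 & 0 < w2].
  by split; rewrite ?mulr_gt0 ?subr_gt0.
pose Q : 'M[R]_(3, n) := \matrix_(i < 3) nth 0 [:: w0 *: x; w1 *: p1; w2 *: p2] i.
pose om : 'cV[R]_3 := \col_i nth 0 [:: w0; w1; w2] i.
have wtE i j k : wt om (row3 i j k) = i * w0 + j * w1 + k * w2.
  by rewrite /wt mxE !big_ord_recl big_ord0 !mxE/= addr0 addrA.
have indep c : wt om c = 0 -> c *m Q = 0 -> c = 0.
  rewrite (row3E c) wtE row3_mul !scalerA.
  move: (c 0 _) (c 0 _) (c 0 _) => c2 c1 c0 wt0 cQ.
  (* Weight zero eliminates the coefficient of [x], leaving a relation between [p1 - x] and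
     [p2 - x]. *)
  have [] := ind (c1 * w1) (c2 * w2).
    rewrite !scalerBr addrACA -opprD -scalerDl.
    rewrite (_ : c1 * w1 + c2 * w2 = - (c0 * w0)); last by move: wt0; lra.
    by rewrite scaleNr opprK addrC addrA.
  have mulI (d w : R) : 0 < w -> d * w = 0 -> d = 0.
    by move=> w_gt0 /eqP; rewrite mulf_eq0 (gt_eqF w_gt0) orbF => /eqP.
  move=> c10 c20; move: wt0; rewrite c10 c20 !addr0 => /(mulI _ _ w00)->.
  rewrite (mulI _ _ w10 c10) (mulI _ _ w20 c20).
  by apply/rowP => -[[|[|[|]]]]// ?; rewrite !mxE.
have om0 i : 0 < om i 0 by rewrite mxE; case: i => -[|[|[|]]].
have E100 : proj Q om (row3 1 0 0) = x.
  by rewrite /proj wtE row3_mul !mul0r !addr0 mul1r !scale0r !addr0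
    scale1r scalerA mulVf ?scale1r// gt_eqF.
have E010 : proj Q om (row3 0 1 0) = p1.
  by rewrite /proj wtE row3_mul !mul0r add0r !addr0 mul1r !scale0r
    !addr0 add0r scale1r scalerA mulVf ?scale1r// gt_eqF.
have E001 : proj Q om (row3 0 0 1) = p2.
  by rewrite /proj wtE row3_mul !mul0r !add0r mul1r !scale0r !add0r
    scale1r scalerA mulVf ?scale1r// gt_eqF.
have E111 : proj Q om (row3 1 1 1) = x + b *: (q - x).
  rewrite /proj wtE row3_mul !mul1r !scale1r.
  rewrite (_ : w0 + w1 + w2 = 1); last by rewrite /w0 /w1 /w2; ring.
  by rewrite invr1 scale1r qE; apply/rowP => i; rewrite !mxE /w0 /w1 /w2; ring.
(* A point of the triangle is at most as far from [x] as the farther of [p1] and [p2], hence within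
   [e]. *)
have ET i j k : 0 <= i -> 0 <= j -> 0 <= k -> 0 < i + j + k ->
    S (proj Q om (row3 i j k)) -> T (proj Q om (row3 i j k)).
  move=> i0 j0 k0 ijk SE; apply: ST; split=> //.
  have W0 := wt_row3_gt0 om0 i0 j0 k0 ijk.
  rewrite euclid_distE.
  have -> : proj Q om (row3 i j k) - x = (j * w1 / wt om (row3 i j k)) *: (p1 - x)
      + (k * w2 / wt om (row3 i j k)) *: (p2 - x).
    move: (lt0r_neq0 W0); rewrite /proj row3_mul wtE => W1.
    by apply/rowP => l; rewrite !mxE; field.
  apply: le_lt_trans (enormD_le _ _) _; rewrite !enormZ.
  have J0 : 0 <= j * w1 by rewrite mulr_ge0// ltW.
  have K0 : 0 <= k * w2 by rewrite mulr_ge0// ltW.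
  have I0 : 0 <= i * w0 by rewrite mulr_ge0// ltW.
  rewrite !ger0_norm ?divr_ge0 ?(ltW W0)//.
  rewrite ![_ / _ * _]mulrAC -mulrDl ltr_pdivrMr//.
  rewrite !euclid_distE in e1 e2.
  have [m [m0 m1 m2]] :
      exists m : R, [/\ m < e, enorm (p1 - x) <= m & enorm (p2 - x) <= m].
    exists (Num.max (enorm (p1 - x)) (enorm (p2 - x))).
    by rewrite gt_max e1 e2 !le_max !lexx orbT.
  apply: (@le_lt_trans _ _ (m * wt om (row3 i j k))).
    have Jm := ler_wpM2l J0 m1; have Km := ler_wpM2l K0 m2.
    have Im : 0 <= (i * w0) * m by rewrite mulr_ge0//; exact: le_trans (enorm_ge0 _) m1.
    by rewrite wtE; move: (i * w0) (j * w1) (k * w2) Jm Km Im => I J K; lra.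
  by rewrite ltr_pM2r.
have G := grid_nat indep om0 Scl.
exists Q, om; split=> //.
- by rewrite E100.
- by split; apply: ET; rewrite ?E010 ?E001//; lra.
- move=> i j; apply: ET => //; first by rewrite ltr_pwDl// ltr_pwDl.
  by apply: G; rewrite ?E100 ?E010 ?E001 ?E111.
Qed.

Local Close Scope ring_scope.

(** * The picture of a finite computation *)

Lemma uniq_map_inj (T1 T2 : eqType) (f : T1 -> T2) (s : seq T1) :
  uniq (map f s) -> {in s &, injective f}.
Proof.
elim: s => //= a s IHs /andP[fas us] x y; rewrite !inE.
move=> /predU1P[->|xs] /predU1P[->|ys]//; last exact: IHs.
  by move=> fay; rewrite fay map_f in fas.
by move=> fxa; rewrite -fxa map_f in fas.
Qed.

Section FactWord.
Variables (lam : label -> nat) (N : nat).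
Hypothesis lam_gt : forall l, N < lam l.

Definition fact_word (F : seq fact) : seq nat :=
  flatten [seq lam f.1 :: f.2 | f <- F].

(** Entries of facts are at most [N] and letters of labels exceed [N], so such a letter can only
    stand at the beginning of a fact. *)
Lemma fact_word_parse F r l :
  (forall f, f \in F -> all (geq N) f.2) ->
  r < size (fact_word F) -> nth 0 (fact_word F) r = lam l ->
  exists f, [/\ f \in F, lam f.1 = lam l & prefix f.2 (drop r.+1 (fact_word F))].
Proof.
elim: F r => //= f F IHF r FN; rewrite /fact_word /= -/(fact_word F).
case: r => [|r] /=; first by exists f; rewrite mem_head drop0 prefix_prefix.
rewrite ltnS size_cat nth_cat; case: (ltnP r (size f.2)) => [rf _ nl|fr rs].
  have /(allP (FN f (mem_head _ _))) := mem_nth 0 rf.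
  by rewrite nl /= leqNgt lam_gt.
move=> /IHF[|| g [gF gl gp]].
- by move=> g gF; apply: FN; rewrite inE gF orbT.
- by rewrite ltn_subLR.
exists g; rewrite inE gF orbT; split=> //.
by rewrite drop_cat ltnNge leqW//= subSn.
Qed.

Lemma fact_word_mem F f : f \in F ->
  exists2 r, r < size (fact_word F) &
    nth 0 (fact_word F) r = lam f.1 /\ prefix f.2 (drop r.+1 (fact_word F)).
Proof.
case/splitPr => F1 F2; exists (size (fact_word F1)).
  by rewrite /fact_word map_cat flatten_cat size_cat /= addnS ltnS leq_addr.
rewrite /fact_word map_cat flatten_cat /=; split.
  by rewrite nth_cat ltnn subnn.
by rewrite drop_cat ltnNge leqnSn/= subSnn /= drop0 prefix_prefix.
Qed.

End FactWord.

(** * The finite model and the relations it defines *)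

Section Model.
Variables (R : realType) (n : nat) (T : set 'rV[R]_n).
Variables (Q : 'M[R]_(3, n)) (om : 'cV[R]_3).
Hypothesis indep : forall a, wt om a = 0%R -> (a *m Q = 0)%R -> a = 0%R.
Hypothesis om_gt0 : forall i, (0 < om i 0)%R.
Hypothesis T100 : T (proj Q om (row3 1 0 0)).
Hypothesis T010 : T (proj Q om (row3 0 1 0)).
Hypothesis T001 : T (proj Q om (row3 0 0 1)).
Hypothesis TG : forall i j, T (proj Q om (row3 1 i%:R j%:R)).

Lemma betw_row3 (a b c a' b' c' a'' b'' c'' : R) :
  (0 <= a -> 0 <= b -> 0 <= c -> 0 < a + b + c ->
   0 <= a' -> 0 <= b' -> 0 <= c' -> 0 < a' + b' + c' ->
   0 <= a'' -> 0 <= b'' -> 0 <= c'' -> 0 < a'' + b'' + c'' ->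
  betw (proj Q om (row3 a b c)) (proj Q om (row3 a' b' c'))
       (proj Q om (row3 a'' b'' c'')) <->
  exists k l, [/\ 0 <= k, 0 <= l, a' = k * a + l * a'',
                  b' = k * b + l * b'' & c' = k * c + l * c''])%R.
Proof.
move=> ? ? ? ? ? ? ? ? ? ? ? ?; rewrite betw_proj//; try exact: wt_row3_gt0.
split=> -[k [l]].
  by rewrite row3_comb => -[k0 l0 /row3_inj[? ? ?]]; exists k, l.
by move=> [k0 l0 -> -> ->]; exists k, l; rewrite row3_comb.
Qed.

Definition mk (p : 'rV[R]_n) (Tp : T p) : set_type T := SigSub (mem_set Tp).

Definition G (i j : nat) : set_type T := mk (TG i j).

Variables (N : nat) (w : seq nat).
Hypothesis wN : all (geq N) w.

(** The grid point with indices 0 and 0 is O itself, hence the shift: the number [v] has abscissa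
    [v.+1], the row [r] has ordinate [r.+1]. *)
Definition x_points := [seq val (G v.+1 0) | v <- iota 0 N.+1].
Definition y_points := [seq val (G 0 r.+1) | r <- iota 0 (size w)].
Definition z_points :=
  [seq val (G (nth 0 w r).+1 r.+1) | r <- iota 0 (size w)].

Definition model_P : set 'rV[R]_n := [set` x_points ++ y_points ++ z_points].

Lemma model_P_sub : model_P `<=` T.
Proof.
move=> p; rewrite -[model_P p]/(is_true (p \in x_points ++ y_points ++ z_points)).
by rewrite !mem_cat => /or3P[] /mapP[i _ ->]; exact: TG.
Qed.

Definition model : structure := betw_structure T model_P.

Let O : model := mk T100.
Let A : model := mk T010.
Let B : model := mk T001.
Let X (v : nat) : model := G v.+1 0.
Let Y (r : nat) : model := G 0 r.+1.
Let Z (r : nat) : model := G (nth 0 w r).+1 r.+1.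

Lemma model_PP (u : model) : P_rel u <->
  [\/ exists2 v, v <= N & u = X v, exists2 r, r < size w & u = Y r
    | exists2 r, r < size w & u = Z r].
Proof.
rewrite -[P_rel u]/(is_true (val u \in x_points ++ y_points ++ z_points)) !mem_cat.
split=> [/or3P[]|].
- move=> /mapP[v]; rewrite mem_iota => /andP[_ vN] /val_inj ->.
  by apply: Or31; exists v.
- move=> /mapP[r]; rewrite mem_iota => /andP[_ rw] /val_inj ->.
  by apply: Or32; exists r.
- move=> /mapP[r]; rewrite mem_iota => /andP[_ rw] /val_inj ->.
  by apply: Or33; exists r.
case=> -[k kN ->]; apply/or3P.
- by apply: Or31; apply: (map_f (fun v => val (G v.+1 0))); rewrite mem_iota.
- by apply: Or32; apply: (map_f (fun r => val (G 0 r.+1))); rewrite mem_iota.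
- by apply: Or33; apply: (map_f (fun r => val (G (nth 0 w r).+1 r.+1))); rewrite mem_iota.
Qed.

Lemma wt_pos i j : (0 < 1 + i%:R + j%:R :> R)%R.
Proof. by rewrite -addrA ltr_pwDl ?ltr01// addr_ge0. Qed.

(** Grid points have first coordinate 1, so cone combinations become convex ones: betweenness is
    that of integer points of the affine plane. *)
Lemma betw_G i j i' j' i'' j'' :
  betw (val (G i j)) (val (G i' j')) (val (G i'' j'')) <->
  (exists k l : R, [/\ 0 <= k, 0 <= l, k + l = 1, i'%:R = k * i%:R + l * i''%:R
     & j'%:R = k * j%:R + l * j''%:R])%R.
Proof.
rewrite betw_row3 ?wt_pos//.
by split=> -[k [l []]]; rewrite ?mulr1 => k0 l0 h e1 e2; exists k, l; rewrite ?mulr1.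
Qed.

Lemma betw_OG i j i' j' :
  betw (val O) (val (G i j)) (val (G i' j')) <->
  (exists l : R, [/\ 0 <= l <= 1, i%:R = l * i'%:R & j%:R = l * j'%:R])%R.
Proof.
rewrite betw_row3 ?wt_pos ?addr0//.
split=> [[k [l []]]|[l [/andP[l0 l1]]]]; rewrite ?mulr1 ?mulr0 ?add0r.
  by move=> k0 l0 e -> ->; exists l; split=> //; rewrite l0 e lerDr.
move=> -> ->; exists (1 - l)%R, l; rewrite ?mulr1 ?mulr0 ?add0r subrK.
by rewrite subr_ge0.
Qed.

Lemma G_inj i j i' j' : G i j = G i' j' -> i = i' /\ j = j'.
Proof.
move=> e; have /betw_G[k [l]] : betw (val (G i j)) (val (G i' j')) (val (G i j)).
  by rewrite e; apply/betwP; exists 0%R; rewrite ?lexx ?ler01// scale0r addr0.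
rewrite -!mulrDl => -[_ _ -> /eqP + /eqP]; rewrite !mul1r !eqr_nat.
by move=> /eqP-> /eqP->.
Qed.

Lemma size_letter r : r < size w -> nth 0 w r <= N.
Proof. by move=> rw; have /(allP wN) := mem_nth 0 rw. Qed.

Lemma P_X v : v <= N -> P_rel (X v).
Proof. by move=> vN; apply/model_PP/Or31; exists v. Qed.

Lemma P_Y r : r < size w -> P_rel (Y r).
Proof. by move=> rw; apply/model_PP/Or32; exists r. Qed.

Lemma P_Z r : r < size w -> P_rel (Z r).
Proof. by move=> rw; apply/model_PP/Or33; exists r. Qed.

Lemma zero_X0 : zero_pt O (X 0).
Proof.
move=> u /model_PP[] [k kN ->] /betw_OG[l [/andP[l0 l1]]]; rewrite ?mulr0.
- rewrite mulr1 => kl _; suff -> : k = 0 by [].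
  by apply/eqP; rewrite -leqn0 -ltnS -(ler_nat R) kl.
- by move=> _ /eqP; rewrite pnatr_eq0.
- by move=> _ /eqP; rewrite pnatr_eq0.
Qed.

Lemma adj_X v : v < N -> adj_pt O (X v) (X v.+1).
Proof.
move=> vN; split.
- exact/P_X/ltnW.
- apply/betw_OG; exists (v.+1%:R / v.+2%:R)%R; rewrite mulr0 divfK ?pnatr_eq0//.
  by rewrite divr_ge0//= ler_pdivrMr ?ltr0n// mul1r ler_nat.
- by move=> /G_inj[/eqP]; rewrite eqSS ltn_eqF.
move=> u /model_PP[] [j jN ->] /betw_G[k [l [k0 l0 kl]]]; rewrite ?mulr0 ?addr0.
- rewrite -[(v.+2%:R)%R]natr1 => jE _.
  have {}jE : (j.+1%:R = v.+1%:R + l)%R.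
    by rewrite jE mulrDr addrA -mulrDl kl mul1r mulr1.
  have l1 : (l <= 1)%R by rewrite -kl lerDr.
  have vj : v <= j by rewrite -ltnS -(ler_nat R) jE lerDl.
  have jv : j <= v.+1 by rewrite -ltnS -(ler_nat R) jE -[(v.+2%:R)%R]natr1 lerD2l.
  have [->|jv'] := eqVneq j v; first by left.
  by right; suff -> : j = v.+1 by []; apply/eqP; rewrite eqn_leq jv ltn_neqAle eq_sym jv'.
- by move=> _ /eqP; rewrite pnatr_eq0.
- by move=> _ /eqP; rewrite pnatr_eq0.
Qed.

Lemma betw_Y r1 r r2 : r1 <= r <= r2 -> betw (val (Y r1)) (val (Y r)) (val (Y r2)).
Proof.
move=> /andP[r1r rr2]; apply/betw_G.
have [e|ne] := eqVneq r1 r2.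
  have -> : r = r1 by apply/eqP; rewrite eqn_leq r1r e rr2.
  by exists 1%R, 0%R; rewrite ?mul1r ?mul0r ?mulr0 ?addr0 ler01 lexx.
have r12 : r1 < r2 by rewrite ltn_neqAle ne (leq_trans r1r).
have d0 : ((r2 - r1)%:R != 0 :> R)%R by rewrite pnatr_eq0 subn_eq0 -ltnNge.
exists ((r2 - r)%:R / (r2 - r1)%:R)%R, ((r - r1)%:R / (r2 - r1)%:R)%R.
rewrite !mulr0 addr0; split; rewrite ?divr_ge0 ?ler0n//.
  by rewrite -mulrDl -natrD addnBA// subnK// divff.
move: d0; rewrite !natrB// ?(ltnW r12)// -!natr1 => d0; by field.
Qed.

Lemma adj_Y r : r.+1 < size w -> adj_pt O (Y r) (Y r.+1).
Proof.
move=> rw; split.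
- exact/P_Y/ltnW.
- apply/betw_OG; exists (r.+1%:R / r.+2%:R)%R; rewrite mulr0 divfK ?pnatr_eq0//.
  by rewrite divr_ge0//= ler_pdivrMr ?ltr0n// mul1r ler_nat.
- by move=> /G_inj[_ /eqP]; rewrite eqSS ltn_eqF.
move=> u /model_PP[] [j jN ->] /betw_G[k [l [k0 l0 kl]]]; rewrite ?mulr0 ?addr0.
- by move=> /eqP; rewrite pnatr_eq0.
- rewrite -[(r.+2%:R)%R]natr1 => _ jE.
  have {}jE : (j.+1%:R = r.+1%:R + l)%R.
    by rewrite jE mulrDr addrA -mulrDl kl mul1r mulr1.
  have l1 : (l <= 1)%R by rewrite -kl lerDr.
  have vj : r <= j by rewrite -ltnS -(ler_nat R) jE lerDl.
  have jv : j <= r.+1 by rewrite -ltnS -(ler_nat R) jE -[(r.+2%:R)%R]natr1 lerD2l.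
  have [->|jv'] := eqVneq j r; first by left.
  by right; suff -> : j = r.+1 by []; apply/eqP; rewrite eqn_leq jv ltn_neqAle eq_sym jv'.
- by move=> /eqP; rewrite pnatr_eq0.
Qed.

(** Beyond [r.+1] the point [Y r.+1] of [P] would lie strictly between. *)
Lemma adj_YP r r' : r' < size w -> adj_pt O (Y r) (Y r') -> r' = r.+1.
Proof.
move=> r'w [_ /betw_OG[l [/andP[l0 l1] _ e]] ne between].
have rr' : r < r'.
  rewrite ltn_neqAle -ltnS -(ler_nat R) e -[leRHS]mul1r ler_wpM2r// andbT.
  by apply/eqP => rr; apply: ne; rewrite rr.
apply/eqP; rewrite eqn_leq rr' andbT leqNgt; apply/negP => rr2.
have := between (Y r.+1) (P_Y (ltn_trans rr2 r'w)).
case; first by apply: betw_Y; rewrite leqnSn.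
  by move=> /G_inj[_ /eqP]; rewrite eqSS gtn_eqF.
by move=> /G_inj[_ /eqP]; rewrite eqSS ltn_eqF.
Qed.

(** A is the point at infinity of the horizontal direction and B of the vertical one: segments to A
    preserve the ordinate, segments to B the abscissa. *)
Lemma betw_O_G_A i j : betw (val O) (val (G i j)) (val A) -> j = 0.
Proof.
rewrite betw_row3 ?wt_pos ?addr0 ?add0r// => -[k [l [_ _ _ _]]].
by rewrite !mulr0 addr0 => /eqP; rewrite pnatr_eq0 => /eqP.
Qed.

Lemma betw_O_G_B i j : betw (val O) (val (G i j)) (val B) -> i = 0.
Proof.
rewrite betw_row3 ?wt_pos ?addr0 ?add0r// => -[k [l [_ _ _]]].
by rewrite !mulr0 addr0 => /eqP; rewrite pnatr_eq0 => /eqP.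
Qed.

Lemma betw_G_G_A i j i' j' :
  betw (val (G i j)) (val (G i' j')) (val A) -> j' = j.
Proof.
rewrite betw_row3 ?wt_pos ?addr0 ?add0r// => -[k [l [_ _]]].
rewrite !mulr0 !addr0 mulr1 => <- _ /eqP; by rewrite mul1r eqr_nat => /eqP.
Qed.

Lemma betw_G_G_B i j i' j' :
  betw (val (G i j)) (val (G i' j')) (val B) -> i' = i.
Proof.
rewrite betw_row3 ?wt_pos ?addr0 ?add0r// => -[k [l [_ _]]].
rewrite !mulr0 !addr0 mulr1 => <- /eqP; by rewrite mul1r eqr_nat => /eqP.
Qed.

Lemma betw_O_A i : betw (val O) (val (G i 0)) (val A).
Proof.
rewrite betw_row3 ?wt_pos ?addr0 ?add0r//; exists 1%R, i%:R%R.
by rewrite !mulr1 !mulr0 !addr0 add0r.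
Qed.

Lemma betw_O_B j : betw (val O) (val (G 0 j)) (val B).
Proof.
rewrite betw_row3 ?wt_pos ?addr0 ?add0r//; exists 1%R, j%:R%R.
by rewrite !mulr1 !mulr0 !addr0 add0r.
Qed.

Lemma betw_G_A i j : betw (val (G 0 j)) (val (G i j)) (val A).
Proof.
rewrite betw_row3 ?wt_pos ?addr0 ?add0r//; exists 1%R, i%:R%R.
by rewrite !mulr1 !mulr0 !addr0 add0r mul1r.
Qed.

Lemma betw_G_B i j : betw (val (G i 0)) (val (G i j)) (val B).
Proof.
rewrite betw_row3 ?wt_pos ?addr0 ?add0r//; exists 1%R, j%:R%R.
by rewrite !mulr1 !mulr0 !addr0 add0r mul1r.
Qed.

(** Betweenness with B and A singles out the [Y] and the [X] points of [P]. The crossing point has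
    positive abscissa and ordinate, so it is some [Z r], which fixes row and letter. *)
Lemma letterP y v : letter O A B y v <->
  exists2 r, r < size w & y = Y r /\ v = X (nth 0 w r).
Proof.
split=> [[[/model_PP Py /model_PP Pv] OyB OvA [q [/model_PP Pq vqB yqA]]]|].
  have [r rw yE] : exists2 r, r < size w & y = Y r.
    by case: Py => -[k kw yE]; move: OyB; rewrite yE => /betw_O_G_B//; exists k.
  have [j jN vE] : exists2 j, j <= N & v = X j.
    by case: Pv => -[k kw vE]; move: OvA; rewrite vE => /betw_O_G_A//; exists k.
  move: yqA vqB; rewrite yE vE.
  case: Pq => -[k kw ->] /betw_G_G_A// rE /betw_G_G_B// jE.
  by move: rE jE => [<-] [<-]; exists k.
move=> [r rw [-> ->]]; have vN := size_letter rw; split.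
- by split; [exact: P_Y|exact: P_X].
- exact: betw_O_B.
- exact: betw_O_A.
by exists (Z r); split; [exact: P_Z|exact: betw_G_B|exact: betw_G_A].
Qed.

Lemma spelledP r xs : r < size w ->
  spelled O A B (Y r) xs <-> exists2 s, xs = map X s & prefix s (drop r.+1 w).
Proof.
elim: xs r => [|x xs IHxs] r rw /=; first by split=> // _; exists [::]; rewrite ?prefix0s.
split=> [[y [ay ly sy]]|[[|v s]//= [-> xsE]]].
  have [r' r'w [yE ->]] := (letterP _ _).1 ly.
  rewrite yE in ay sy; have rE := adj_YP r'w ay; rewrite rE in r'w sy *.
  have [s -> ps] := (IHxs _ r'w).1 sy.
  by exists (nth 0 w r.+1 :: s); rewrite // (drop_nth 0 r'w) /= eqxx.
have [r1w|r1w] := ltnP r.+1 (size w); last by rewrite drop_oversize.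
rewrite (drop_nth 0 r1w) prefix_cons => /andP[/eqP-> ps].
exists (Y r.+1); split; first exact: adj_Y.
  by apply/letterP; exists r.+1.
by apply/(IHxs _ r1w); exists s.
Qed.

Lemma word_relP L xs :
  word_rel O A B (X L) xs <->
  exists2 r, r < size w /\ nth 0 w r = L
    & exists2 s, xs = map X s & prefix s (drop r.+1 w).
Proof.
split=> [[y /letterP[r rw [-> /G_inj[[LE] _]]] /spelledP h]|[r [rw <-] h]].
  by exists r => //; exact: h.
exists (Y r); first by apply/letterP; exists r.
exact/spelledP.
Qed.

Lemma adj_iter_X k m : k + m <= N -> adj_iter O m (X k) (X (k + m)).
Proof.
elim: m k => [|m IHm] k kN /=; first by rewrite addn0.
exists (X k.+1); first by apply: adj_X; rewrite (leq_trans _ kN)// addnS ltnS leq_addr.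
by rewrite -addSnnS; apply: IHm; rewrite addSnnS.
Qed.

End Model.

Lemma justified_model (R : realType) n (T : set 'rV[R]_n) (Rs : seq rule)
    (root : label) (N x y : nat) (F : seq fact) :
  (0 < n)%N -> extends_linearly_in_2D T ->
  uniq (map rlabel Rs) -> justified Rs N F -> fact_rel F root [:: 0; x; y] ->
  exists P (rho : nat -> betw_structure T P), [/\ P `<=` T, finite_set P
    & sat rho (fMain (map rlabel Rs) Rs root x)].
Proof.
move=> n0 /(exists_frame n0)[Q [om [indep om0 T100 [T010 T001] TG]]] uRs jF rootF.
set labs := map rlabel Rs.
(* Letters up to [N] are numbers, the following ones stand for labels. *)
pose lam l := N.+1 + index l labs.
have lam_gt l : N < lam l by rewrite ltnS leq_addr.
have FN f : f \in F -> all (geq N) f.2.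
  move=> /jF[r _ [_ [b _ [e [eN <- _]]]]]; apply/allP => v /mapP[i _ ->]; exact: eN.
pose w := fact_word lam F; pose M := N.+1 + size labs.
have lamM l : lam l <= M by rewrite leq_add2l index_size.
have wM : all (geq M) w.
  apply/allP => v /flatten_mapP[f fF]; rewrite inE => /predU1P[->|vf]; first exact: lamM.
  by rewrite /= (leq_trans (allP (FN f fF) v vf))// (leq_trans (ltnW (lam_gt root))).
pose X v : model TG M w := G TG v.+1 0.
(* The variables 0, 1, 2 receive O, A, B; the shift by 3 matches [vLabel], so each label variable
   receives the point of its letter. *)
pose rho i : model TG M w :=
  if i is i'.+3 then X (N.+1 + i') else nth (X 0) [:: mk T100; mk T010; mk T001] i.
have relE l xs : rho_rel labs rho l xs <->
    word_rel (mk T100 : model TG M w) (mk T010) (mk T001) (X (lam l)) xs by [].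
have rel_fact l s : fact_rel F l s -> rho_rel labs rho l (map X s).
  move=> /(fact_word_mem lam)[r rw [nr pr]].
  by apply/relE/word_relP => //; exists r => //; exists s.
have rule_of f : f \in F -> exists2 r, r \in Rs & rlabel r = f.1.
  by move=> /jF[r rRs [rf _]]; exists r.
exists (model_P TG M w), rho; split.
- exact: model_P_sub.
- by apply/finite_seqP; eexists; reflexivity.
apply/sat_fMain; split.
  move=> r rRs e; rewrite relE => /word_relP -/(_ indep om0 wM)[k [kw nk] [s sE ps]].
  have [f [fF /addnI lf pf]] := fact_word_parse lam_gt FN kw nk.
  have [r' r'Rs [r'f [b br [e' [e'N e'f hb]]]]] := jF f fF.
  (* Equal letters give equal indices in [labs], hence equal labels, hence the same rule. *)
  have r'r : r' = r.
    apply: (uniq_map_inj uRs) => //; rewrite r'f.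
    have : nth [::] labs (index f.1 labs) = nth [::] labs (index (rlabel r) labs).
      by rewrite lf.
    by rewrite !nth_index// -?r'f map_f.
  rewrite r'r in br e'f; exists b => //; exists (fun i => X (e' i)).
    (* Both lists are prefixes of the word after the same position and have the arity of the rule as
       length. *)
    have sf : s = f.2.
      have ss : size s = size f.2.
        by have := congr1 size sE; rewrite !size_map -e'f size_map.
      by move: ps pf; rewrite !prefixE ss => /eqP-> /eqP.
    move=> i ia; have := sE; rewrite sf -e'f -map_comp.
    by move=> /eq_in_map/(_ i); rewrite mem_iota => /(_ ia).
  apply/clause_holdsP => a ab; have := (clause_holdsP _ _ _ _ _).1 hb a ab.
  case: a {ab} => [u|u v|u v|l xs] /=.
  - by move=> ->; exact: zero_X0.
  - rewrite /succ_rel => uv; rewrite uv; apply: adj_X => //.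
    by apply: leq_trans (leq_addr _ _); rewrite ltnS.
  - by move=> ->.
  - by move=> /rel_fact; rewrite -map_comp.
have xN : x <= N by have /allP := FN _ rootF; apply; rewrite !inE eqxx orbT.
exists (X 0), (X x), (X 0), (X y); split.
- exact: zero_X0.
- by apply: (@adj_iter_X _ _ _ _ _ _ _ T100 _ _ _ 0);
    rewrite // (leq_trans xN)// ltnW// ltnS leq_addr.
- exact: zero_X0.
- exact: (rel_fact _ [:: 0; x; y]).
Qed.

(** * The reduction *)

Lemma theory_codesE K phi : theory_codes K (godel_code phi) <-> theory K phi.
Proof.
split=> [[psi h /godel_code_inj <-]//|h]; by exists phi.
Qed.

Theorem theorem5p7 (R : realType) (n : nat) (T : set 'rV[R]_n) :
  (1 <= n)%N ->
  extends_linearly_in_2D T ->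
  Pi01_hard (theory_codes (finite_P_class T)).
Proof.
move=> n0 T2 K [r [c cP] KP].
pose Rs := rules c [::]; pose labs := map rlabel Rs.
exists (fun x => godel_code (fSentence labs Rs [::] x)).
  exact: computable1_fSentence.
move=> x; rewrite theory_codesE; split=> [/KP Kx|[_ models_x]].
  split; first exact: sentence_fSentence.
  move=> M [P [PT Pfin ->]]; apply/models_fSentence => rho /sat_fMain.
  move=> [hR [v0 [v [z [y [hv0 hv hz hq]]]]]].
  have [rk [rk0 rkS]] := finite_rank (rho 0) PT Pfin.
  have := rules_sound rk0 rkS hR (xs := [tuple v; y]) hq.
  have -> : map_tuple rk [tuple v; y] = [tuple x; rk y].
    apply: val_inj => /=; congr (_ :: _).
    (* Every adjacent step raises the rank by one, so [v] has rank [x]. *)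
    have : rk v = rk v0 + x.
      elim: x v0 {hv0 Kx} hv => [|x IHx] v0 /=; first by move=> ->; rewrite addn0.
      by move=> [u /rkS uE /IHx]; rewrite uE addSnnS.
    by rewrite (rk0 _ hv0).
  (* The picture yields output 0 on [x] and [rk y], while [cP] and [K x] yield output 1. *)
  move=> /rec_eval_fun -/(_ _ (cP _)); rewrite (rk0 _ hz).
  by rewrite !(tnth_nth 0) /= Kx.
(* A counterexample [y] has a finite computation with output 0, and its picture in [T] refutes the
   sentence. *)
apply/KP => y; apply: contrapT => /negP/negbTE rxy.
have cxy : rec_eval c [tuple x; y] 0.
  by have := cP [tuple x; y]; rewrite !(tnth_nth 0) /= rxy.
have [N [F [jF Fxy]]] := rules_complete (Rs := Rs) (fun _ h => h) cxy.
have [P [rho [PT Pfin hrho]]] :=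
  justified_model n0 T2 (uniq_rlabel_rules c [::]) jF Fxy.
have /models_fSentence : models (betw_structure T P) (fSentence labs Rs [::] x).
  by apply: models_x; exists P.
by move=> /(_ rho).
Qed.
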